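(* Let $B\supseteq C$ be a unital inclusion of $C^*$-algebras, $\theta:C\to B$ an injective unital $*$-homomorphism, $E_C^B:B\to C$ and $E_{\theta(C)}^B:B\to\theta(C)$ non-degenerate conditional expectations, and let $(A,E_B^A,u(\theta))=(B,E_C^B)\bigstar_C(\theta,E_{\theta(C)}^B)$ be the reduced HNN extension. Let $$(\mathcal{A},\mathcal{E}):=\big(B\otimes M_2(\mathbf{C}),E_\theta:\iota_\theta\big)\bigstar_{C\oplus C}\big(C\otimes M_2(\mathbf{C}),E_1:\iota_1\big)$$ be the reduced amalgamated free product of $C^*$-algebras with canonical embeddings $\lambda_\theta:B\otimes M_2(\mathbf{C})\to\mathcal{A}$, $\lambda_1:C\otimes M_2(\mathbf{C})\to\mathcal{A}$, where $\iota_\theta((c_1,c_2))=\begin{bmatrix}c_1&0\\0&\theta(c_2)\end{bmatrix}$, $\iota_1((c_1,c_2))=\begin{bmatrix}c_1&0\\0&c_2\end{bmatrix}$, $E_\theta([b_{ij}])=\begin{bmatrix}E_C^B(b_{11})&0\\0&E_{\theta(C)}^B(b_{22})\end{bmatrix}$, $E_1([c_{ij}])=\begin{bmatrix}c_{11}&0\\0&c_{22}\end{bmatrix}$. Let $\mathcal{E}_\theta$ be the conditional expectation from $\mathcal{A}$ onto $\lambda_\theta(B\otimes M_2(\mathbf{C}))$ satisfying $\mathcal{E}\circ\mathcal{E}_\theta=\mathcal{E}$. Then there is a bijective $*$-homomorphism $\Phi:\mathcal{A}\to A\otimes M_2(\mathbf{C})$ such that $\Phi(\lambda_\theta(B\otimes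 M_2(\mathbf{C})))=B\otimes M_2(\mathbf{C})\subseteq A\otimes M_2(\mathbf{C})$ and $$\Phi\circ\mathcal{E}_\theta=(E_B^A\otimes\mathrm{Id})\circ\Phi,$$ and $\Phi$ is precisely given by $$\lambda_1\Big(\begin{bmatrix}0&1\\0&0\end{bmatrix}\Big)\lambda_\theta\Big(\begin{bmatrix}0&0\\1&0\end{bmatrix}\Big)\mapsto\begin{bmatrix}u(\theta)&0\\0&0\end{bmatrix},\quad \lambda_\theta\Big(\begin{bmatrix}b&0\\0&0\end{bmatrix}\Big)\mapsto\begin{bmatrix}b&0\\0&0\end{bmatrix}\ (b\in B),\quad \lambda_\theta\Big(\begin{bmatrix}0&1\\0&0\end{bmatrix}\Big)\mapsto\begin{bmatrix}0&1\\0&0\end{bmatrix}.$$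
   Context: A conditional expectation $E:B\to C$ is non-degenerate if its GNS representation (of $B$ on the Hilbert $C$-module obtained from $B$ with inner product $E(x^*y)$) is faithful; equivalently, $E(x^*b^*bx)=0$ for all $x\in B$ implies $b=0$. Reduced HNN extension. For $B\supseteq C$, $\theta$, $E_C^B$, $E_{\theta(C)}^B$ as in the claim, the reduced HNN extension $(B,E_C^B)\bigstar_C(\theta,E_{\theta(C)}^B)$ is the unique triple $(A,E_B^A,u(\theta))$ consisting of a $C^*$-algebra $A\supseteq B$ (unital inclusion), a non-degenerate conditional expectation $E_B^A:A\to B$ and a unitary $u(\theta)\in A$, such that $A$ is generated as a $C^*$-algebra by $B$ and $u(\theta)$ and: (A) $u(\theta)\theta(c)u(\theta)^*=c$ for all $c\in C$; (M) $E_B^A(w)=0$ for every reduced word $w$. A word $w=u(\theta)^{\varepsilon_0}b_1u(\theta)^{\varepsilon_1}b_2\cdots b_\ell u(\theta)^{\varepsilon_\ell}$ ($\ell\ge0$, $b_j\in B$, $\varepsilon_j\in\{1,-1\}$) is reduced if for every $j$ with $\varepsilon_{j-1}\neq\varepsilon_j$: $b_j\in\mathrm{Ker}\,E_{\theta(C)}^B$ when $\varepsilon_{j-1}=1,\varepsilon_j=-1$, and $b_j\in\mathrm{Ker}\,E_C^B$ when $\varepsilon_{j-1}=-1,\varepsilon_j=1$. Reduced amalgamated free product. Given unital embeddings $\iota_i:Q\to P_i$ ($i=1,2$) of $C^*$-algebras and non-degenerate conditional expectations $E_i:P_i\to\iota_i(Q)$, the reduced amalgamated free product $(P,E)=(P_1,E_1:\iota_1)\bigstar_Q(P_2,E_2:\iota_2)$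 is the unique $C^*$-algebra $P$ with embeddings $\lambda_i:P_i\to P$ such that $\lambda:=\lambda_1\circ\iota_1=\lambda_2\circ\iota_2$, $P$ is generated by $\lambda_1(P_1)\cup\lambda_2(P_2)$, and with a non-degenerate conditional expectation $E:P\to\lambda(Q)$ such that $E\circ\lambda_i=\lambda_i\circ E_i$ and $E(x_1\cdots x_m)=0$ whenever $x_j\in\lambda_{i_j}(\mathrm{Ker}E_{i_j})$ with $i_1\ne i_2\ne\cdots\ne i_m$. In the claim $Q=C\oplus C$. Elements of $B\otimes M_2(\mathbf{C})$ are written as $2\times 2$ matrices over $B$. *)

(* Defs.v *)
From Stdlib Require List.
From HB Require Import structures.
From mathcomp Require Import all_boot all_order all_algebra.
From mathcomp Require Import complex.
From mathcomp Require Import all_classical all_reals.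

Set Implicit Arguments.
Unset Strict Implicit.
Unset Printing Implicit Defensive.

Import Order.TTheory GRing.Theory Num.Theory.

Local Open Scope classical_set_scope.
Local Open Scope ring_scope.

HB.mixin Record hasStar (R : realType) A of GRing.Algebra R[i] A := {
  star : A -> A;
  starK : involutive star;
  starD : {morph star : x y / x + y};
  starZ : forall (z : R[i]) x, star (z *: x) = z^*%C *: star x;
  starM : forall x y, star (x * y) = star y * star x
}.

#[short(type="starAlgType")]
HB.structure Definition StarAlgebra (R : realType) :=
  {A of hasStar R A & GRing.Algebra R[i] A}.

(* The norm is R-valued and kept apart from the norm of [numdomain]: Hierarchy
   Builder accepts no join of a ring with a [normedZmodType] declared after
   [numDomainType]. Completeness is stated for Cauchy sequences. *)
HB.mixin Record StarAlgebra_isCStar (R : realType) A of StarAlgebra R A := {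
  cnorm : A -> R;
  cnorm_eq0 : forall x, cnorm x = 0 -> x = 0;
  cnormD : forall x y, cnorm (x + y) <= cnorm x + cnorm y;
  cnormZ : forall (z : R[i]) x,
    cnorm (z *: x) = ComplexField.Normc.normc z * cnorm x;
  cnormM : forall x y, cnorm (x * y) <= cnorm x * cnorm y;
  cnorm_star : forall x, cnorm (star x * x) = cnorm x ^+ 2;
  cnorm_complete : forall s : nat -> A,
    (forall e : R, 0 < e -> exists N : nat, forall m n : nat,
       (N <= m)%N -> (N <= n)%N -> cnorm (s m - s n) < e) ->
    exists l : A, forall e : R, 0 < e -> exists N : nat, forall n : nat,
       (N <= n)%N -> cnorm (s n - l) < e
}.

#[short(type="cstarAlgType")]
HB.structure Definition CStarAlgebra (R : realType) :=
  {A of StarAlgebra R A & StarAlgebra_isCStar R A}.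

HB.mixin Record isStarPreserving (R : realType) (A B : starAlgType R)
    (f : A -> B) := {
  star_morph : {morph f : x / star x}
}.

HB.structure Definition StarHom (R : realType) (A B : starAlgType R) :=
  {f of isStarPreserving R A B f & @GRing.LRMorphism R[i] A B *:%R f}.

Notation "{ 'starhom' A -> B }" := (StarHom.type A B)
  (at level 0, A at level 98, B at level 99,
   format "{ 'starhom'  A  ->  B }") : type_scope.

Section StarTheory.
Variables (R : realType) (A : starAlgType R).

Lemma star0 : star (0 : A) = 0.
Proof. by apply: (addIr (star 0)); rewrite -starD !add0r. Qed.

End StarTheory.
Arguments star0 {R} A.

Section Product.
Variables (R : realType) (A B : starAlgType R).

Definition pair_star (x : A * B) : A * B := (star x.1, star x.2).

Fact pair_starK : involutive pair_star.
Proof. by case=> a b; rewrite /pair_star /= !starK. Qed.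
Fact pair_starD : {morph pair_star : x y / x + y}.
Proof. by move=> x y; rewrite /pair_star /= !starD. Qed.
Fact pair_starZ (z : R[i]) x : pair_star (z *: x) = z^*%C *: pair_star x.
Proof. by rewrite /pair_star /= !starZ. Qed.
Fact pair_starM x y : pair_star (x * y) = pair_star y * pair_star x.
Proof. by rewrite /pair_star /= !starM. Qed.

HB.instance Definition _ := hasStar.Build R (A * B)%type
  pair_starK pair_starD pair_starZ pair_starM.

End Product.

(* B (x) M_2(C), as a *-algebra over the complex numbers; an alias is needed
   because the canonical scaling of ['M[B]_2] is by B. Its C*-norm is unique and
   determined by the *-algebra structure, and only that structure is used here:
   *-homomorphisms and their bijectivity do not refer to the norm. *)
Definition M2 (R : realType) (B : starAlgType R) : Type := 'M[B]_2.

Section MatrixStarAlgebra.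
Variables (R : realType) (B : starAlgType R).

HB.instance Definition _ := GRing.NzRing.copy (M2 B) 'M[B]_2.

Definition M2_scale (z : R[i]) (x : M2 B) : M2 B := map_mx ( *:%R z) x.

Fact M2_scaleA z t x : M2_scale z (M2_scale t x) = M2_scale (z * t) x.
Proof. by apply/matrixP=> i j; rewrite !mxE scalerA. Qed.
Fact M2_scale1 : left_id 1 M2_scale.
Proof. by move=> x; apply/matrixP=> i j; rewrite !mxE scale1r. Qed.
Fact M2_scaleDr : right_distributive M2_scale +%R.
Proof. by move=> z x y; apply/matrixP=> i j; rewrite !mxE scalerDr. Qed.
Fact M2_scaleDl x : {morph M2_scale^~ x : z t / z + t}.
Proof. by move=> z t; apply/matrixP=> i j; rewrite !mxE scalerDl. Qed.

HB.instance Definition _ := GRing.Zmodule_isLmodule.Build R[i] (M2 B)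
  M2_scaleA M2_scale1 M2_scaleDr M2_scaleDl.

Fact M2_scaleAl (z : R[i]) (x y : M2 B) : z *: (x * y) = z *: x * y.
Proof.
apply/matrixP=> i j; rewrite !mxE scaler_sumr.
by apply: eq_bigr => k _; rewrite mxE scalerAl.
Qed.

HB.instance Definition _ := GRing.Lmodule_isLalgebra.Build R[i] (M2 B)
  M2_scaleAl.

Fact M2_scaleAr (z : R[i]) (x y : M2 B) : z *: (x * y) = x * (z *: y).
Proof.
apply/matrixP=> i j; rewrite !mxE scaler_sumr.
by apply: eq_bigr => k _; rewrite mxE scalerAr.
Qed.

HB.instance Definition _ := GRing.Lalgebra_isAlgebra.Build R[i] (M2 B)
  M2_scaleAr.

Definition M2_star (x : M2 B) : M2 B := \matrix_(i, j) star (x j i).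

Fact M2_starK : involutive M2_star.
Proof. by move=> x; apply/matrixP=> i j; rewrite !mxE starK. Qed.
Fact M2_starD : {morph M2_star : x y / x + y}.
Proof. by move=> x y; apply/matrixP=> i j; rewrite !mxE starD. Qed.
Fact M2_starZ (z : R[i]) x : M2_star (z *: x) = z^*%C *: M2_star x.
Proof. by apply/matrixP=> i j; rewrite !mxE starZ. Qed.
Fact M2_starM x y : M2_star (x * y) = M2_star y * M2_star x.
Proof.
apply/matrixP=> i j; rewrite !mxE (big_morph star (@starD R B) (star0 B)).
by apply: eq_bigr => k _; rewrite starM !mxE.
Qed.

HB.instance Definition _ := hasStar.Build R (M2 B)
  M2_starK M2_starD M2_starZ M2_starM.

(* [a b; c d] *)
Definition mat2 (a b c d : B) : M2 B :=
  \matrix_(i, j) (if i == 0 then if j == 0 then a else b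
                  else if j == 0 then c else d).

Lemma mat2D a b c d a' b' c' d' :
  mat2 a b c d + mat2 a' b' c' d' = mat2 (a + a') (b + b') (c + c') (d + d').
Proof.
by apply/matrixP=> i j; rewrite !mxE; case: (i == 0); case: (j == 0).
Qed.

Lemma mat2B a b c d a' b' c' d' :
  mat2 a b c d - mat2 a' b' c' d' = mat2 (a - a') (b - b') (c - c') (d - d').
Proof.
by apply/matrixP=> i j; rewrite !mxE; case: (i == 0); case: (j == 0).
Qed.

Lemma mat2Z (z : R[i]) a b c d :
  z *: mat2 a b c d = mat2 (z *: a) (z *: b) (z *: c) (z *: d).
Proof.
by apply/matrixP=> i j; rewrite !mxE; case: (i == 0); case: (j == 0).
Qed.

Lemma mat2M a b c d a' b' c' d' :
  mat2 a b c d * mat2 a' b' c' d' =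
  mat2 (a * a' + b * c') (a * b' + b * d') (c * a' + d * c') (c * b' + d * d').
Proof.
apply/matrixP=> i j; rewrite !mxE !big_ord_recl big_ord0 !mxE /= addr0.
by case: (i == 0); case: (j == 0).
Qed.

Lemma mat2_star a b c d :
  star (mat2 a b c d) = mat2 (star a) (star c) (star b) (star d).
Proof.
by apply/matrixP=> i j; rewrite !mxE; case: (i == 0); case: (j == 0).
Qed.

Lemma mat2_1 : 1 = mat2 1 0 0 1.
Proof.
apply/matrixP=> i j; rewrite !mxE.
by case: (unliftP 0 i) => [i'|] ->; case: (unliftP 0 j) => [j'|] ->;
  rewrite ?ord1.
Qed.

End MatrixStarAlgebra.

Definition M2map (R : realType) (A B : starAlgType R) (f : A -> B) (x : M2 A) :
  M2 B := map_mx f x.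

Section ConditionalExpectation.
Variable R : realType.

(* The vector b x of the GNS module of E is null exactly when
   E (x^* b^* b x) = 0, so this says that the GNS representation is injective. *)
Definition nondegenerate_ce (B : starAlgType R) (E : B -> B) :=
  forall b : B, (forall x : B, E (star x * star b * b * x) = 0) -> b = 0.

(* E is a conditional expectation onto the C*-subalgebra D. An element of a
   C*-algebra is positive iff it has the form y^* y. *)
Record cond_exp (B : cstarAlgType R) (D : set B) (E : B -> B) : Prop := {
  cond_exp_linear : forall (z : R[i]) x y, E (z *: x + y) = z *: E x + E y;
  cond_exp_range : forall x, D (E x);
  cond_exp_id : forall d, D d -> E d = d;
  cond_exp_bimodule : forall d x d', D d -> D d' -> E (d * x * d') = d * E x * d';
  cond_exp_positive : forall x, exists y, E (star x * x) = star y * y;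
  cond_exp_contractive : forall x, cnorm (E x) <= cnorm x
}.

Record star_subalgebra (A : starAlgType R) (S : set A) : Prop := {
  star_subalgebraD : forall x y, S x -> S y -> S (x + y);
  star_subalgebraZ : forall (z : R[i]) x, S x -> S (z *: x);
  star_subalgebraM : forall x y, S x -> S y -> S (x * y);
  star_subalgebra_star : forall x, S x -> S (star x)
}.

Definition norm_closed (A : cstarAlgType R) (S : set A) :=
  forall x, (forall e : R, 0 < e -> exists2 y, S y & cnorm (x - y) < e) -> S x.

(* The smallest norm-closed *-subalgebra containing X is the whole algebra. *)
Definition cstar_generated (A : cstarAlgType R) (X : set A) :=
  forall S : set A, norm_closed S -> star_subalgebra S -> X `<=` S -> S = setT.

End ConditionalExpectation.

(* The inclusions C <= B and B <= A are the injective *-homomorphisms iC and jB;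
   EC and Etheta map B onto iC(C) and theta(C), and EB maps A onto jB(B). *)
Section ReducedHNN.
Variables (R : realType) (B C A : cstarAlgType R).
Variables (iC theta : {starhom C -> B}) (EC Etheta : B -> B).
Variables (jB : {starhom B -> A}) (EB : A -> A) (u : A).

(* Exponents are booleans: [true] is 1 and [false] is -1 and u^-1 is [star u]. *)
Definition upow (e : bool) : A := if e then u else star u.

(* u^e0 b_1 u^e1 ... b_l u^el, with s = [:: (b_1, e1); ...; (b_l, el)] *)
Fixpoint word (e0 : bool) (s : seq (B * bool)) : A :=
  if s is (b, e1) :: s' then upow e0 * jB b * word e1 s' else upow e0.

Fixpoint reduced (e0 : bool) (s : seq (B * bool)) : Prop :=
  if s is (b, e1) :: s' then
    [/\ e0 = true -> e1 = false -> Etheta b = 0,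
        e0 = false -> e1 = true -> EC b = 0
      & reduced e1 s']
  else True.

Record reduced_HNN : Prop := {
  HNN_inj : injective jB;
  HNN_unitaryl : star u * u = 1;
  HNN_unitaryr : u * star u = 1;
  HNN_cond_exp : cond_exp (range jB) EB;
  HNN_nondegenerate : nondegenerate_ce EB;
  HNN_generated : cstar_generated (range jB `|` [set u]);
  HNN_covariant : forall c, u * jB (theta c) * star u = jB (iC c);
  HNN_reduced : forall e0 s, reduced e0 s -> EB (word e0 s) = 0
}.

End ReducedHNN.

(* The characterization only involves the *-algebra structure of Q, P1 and P2,
   so the C*-norms of M_2(B), M_2(C) and C (+) C need not be exhibited. *)
Section ReducedFreeProduct.
Variables (R : realType) (Q P1 P2 : starAlgType R) (P : cstarAlgType R).
Variables (iota1 : {starhom Q -> P1}) (iota2 : {starhom Q -> P2}).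
Variables (E1 : P1 -> P1) (E2 : P2 -> P2).
Variables (lam1 : {starhom P1 -> P}) (lam2 : {starhom P2 -> P}) (E : P -> P).

Definition letter_side (x : P1 + P2) : bool := if x is inl _ then true else false.

Definition letter_val (x : P1 + P2) : P :=
  match x with inl p => lam1 p | inr p => lam2 p end.

Definition letter_centered (x : P1 + P2) : Prop :=
  match x with inl p => E1 p = 0 | inr p => E2 p = 0 end.

Definition alternating (s : seq (P1 + P2)) : bool :=
  sorted (fun x y => letter_side x != letter_side y) s.

Record reduced_amalgamated_free_product : Prop := {
  rafp_inj1 : injective lam1;
  rafp_inj2 : injective lam2;
  rafp_amalg : forall q, lam1 (iota1 q) = lam2 (iota2 q);
  rafp_generated : cstar_generated (range lam1 `|` range lam2);
  rafp_cond_exp : cond_exp (range (lam1 \o iota1)) E;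
  rafp_nondegenerate : nondegenerate_ce E;
  rafp_E1 : forall x, E (lam1 x) = lam1 (E1 x);
  rafp_E2 : forall x, E (lam2 x) = lam2 (E2 x);
  rafp_free : forall s : seq (P1 + P2), s <> [::] -> alternating s ->
    List.Forall letter_centered s ->
    E (\prod_(x <- s) letter_val x) = 0
}.

End ReducedFreeProduct.

(* (c_1, c_2) |-> [f c_1 0; 0 g c_2] *)
Section Iota.
Variables (R : realType) (B C : starAlgType R) (f g : {starhom C -> B}).

Definition iota_diag (c : C * C) : M2 B := mat2 (f c.1) 0 0 (g c.2).

Fact iota_diag_is_zmod_morphism : zmod_morphism iota_diag.
Proof. by move=> x y; rewrite /iota_diag mat2B !subr0 /= !raddfB. Qed.
Fact iota_diag_is_monoid_morphism : monoid_morphism iota_diag.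
Proof.
split=> [|x y]; first by rewrite mat2_1 /iota_diag /= !rmorph1.
by rewrite /iota_diag mat2M !mulr0 !mul0r !addr0 !add0r /= !rmorphM.
Qed.
Fact iota_diag_is_scalable : scalable iota_diag.
Proof. by move=> z x; rewrite /iota_diag mat2Z !scaler0 /= !linearZ. Qed.
Fact iota_diag_star : {morph iota_diag : x / star x}.
Proof. by move=> x; rewrite /iota_diag mat2_star !star0 /= !star_morph. Qed.

HB.instance Definition _ :=
  GRing.isZmodMorphism.Build (C * C)%type (M2 B) iota_diag
    iota_diag_is_zmod_morphism.
HB.instance Definition _ :=
  GRing.isMonoidMorphism.Build (C * C)%type (M2 B) iota_diag
    iota_diag_is_monoid_morphism.
HB.instance Definition _ :=
  GRing.isScalable.Build R[i] (C * C)%type (M2 B) *:%R iota_diag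
    iota_diag_is_scalable.
HB.instance Definition _ :=
  isStarPreserving.Build R (C * C)%type (M2 B) iota_diag iota_diag_star.

End Iota.

HB.instance Definition _ (R : realType) (A : starAlgType R) :=
  isStarPreserving.Build R A A idfun (fun=> erefl).

(* [x_ij] |-> [f x_11 0; 0 g x_22] (matrix indices start at 0) *)
Definition E_diag (R : realType) (B : starAlgType R) (f g : B -> B) (x : M2 B) :
    M2 B :=
  mat2 (f (x 0 0)) 0 0 (g (x 1 1)).

(* Main.v *)
Require Import Defs.
From HB Require Import structures.
From mathcomp Require Import all_boot all_order all_algebra.
From mathcomp Require Import complex ring lra.
From mathcomp Require Import all_classical all_reals.

(* Let [v] be the matrix unit [e_12] of [M_2(C)] and [e_ij] those of [M_2(B)] inside the
   free product [AA].  Then [AA = M_2(D)], where [D] is the commutant of the [e_ij],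
   and the entry [W] of [v] is a unitary of [D] implementing [theta].  A reduced word
   in [W] and [B], compressed to the corner [e_11], is an alternating product of
   off-diagonal elements of [M_2(C)] and centered elements of [M_2(B)] up to its two
   ends, so [EEtheta] kills it.  Hence [EB] and [EEtheta] agree on polynomials in
   ([B], [u]) and in ([B], [W]).  Non-degeneracy says that a self-adjoint [h] is positive
   as soon as all [E (x^* h x)] are: test against [x = n y], where [n] is the negative
   part of [h].  So corresponding polynomials are simultaneously positive, therefore
   have equal norms, and the correspondence extends by closure to an isomorphism
   of [A] onto [D]. *)

Set Implicit Arguments.
Unset Strict Implicit.
Unset Printing Implicit Defensive.

Import Order.TTheory GRing.Theory Num.Theory.

Local Open Scope classical_set_scope.
Local Open Scope ring_scope.

(** * Norm estimates and square roots *)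

(** No GNS module is built. The norm is read off the order instead: [cnorm y <= c] is equivalent to
    positivity of [c ^+ 2 - star y * y], so a correspondence preserving positivity both ways is
    isometric. Positivity is a norm condition, and the only functions of an element ever needed are
    square roots, obtained from one explicit iteration. Two obstacles shape the rest. The
    correspondence between polynomials in ([B], [u]) and in ([B], [W]) is not known to be
    single-valued beforehand, so it is carried as a relation, and its being a bijection is a
    consequence of isometry. Moreover, non-degeneracy in the free product is tested by all vectors,
    while only vectors of [D] can be approximated by polynomials with a partner in [A]; the matrix
    units close this gap, because null vectors are stable under right multiplication by them and
    every entry is a limit of polynomials in [B] and [W]. Freeness speaks of [EE] only; it reaches
    [EEtheta] because [E_diag] is itself non-degenerate. *)

Section NormTheory.
Variables (R : realType) (A : cstarAlgType R).
Implicit Types (x y z : A) (r : R).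

Lemma starN x : star (- x) = - star x.
Proof. by rewrite -scaleN1r starZ rmorphN1 scaleN1r. Qed.

Lemma starB x y : star (x - y) = star x - star y.
Proof. by rewrite starD starN. Qed.

Lemma star1 : star (1 : A) = 1.
Proof. by rewrite -[LHS]mulr1 -{2}[1]starK -starM mulr1 starK. Qed.

Lemma star_scale r x : star (r%:C%C *: x) = r%:C%C *: star x.
Proof. by rewrite starZ /= oppr0. Qed.

Lemma cnorm_scale r x : cnorm (r%:C%C *: x) = `|r| * cnorm x.
Proof. by rewrite cnormZ /= expr0n addr0 sqrtr_sqr. Qed.

Lemma cnorm0 : cnorm (0 : A) = 0.
Proof. by rewrite -(scale0r (0 : A)) (cnorm_scale 0) normr0 mul0r. Qed.

Lemma cnormN x : cnorm (- x) = cnorm x.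
Proof.
rewrite -scaleN1r (_ : -1 = (-1)%:C%C) ?cnorm_scale ?normrN1 ?mul1r //.
by rewrite rmorphN1.
Qed.

Lemma cnormBC x y : cnorm (x - y) = cnorm (y - x).
Proof. by rewrite -cnormN opprB. Qed.

Lemma cnorm_ge0 x : 0 <= cnorm x.
Proof.
have := cnormD x (- x); rewrite subrr cnorm0 cnormN => h; lra.
Qed.

Lemma cnorm_dist x y z : cnorm (x - z) <= cnorm (x - y) + cnorm (y - z).
Proof. by apply: le_trans (cnormD _ _); rewrite addrA subrK. Qed.

Lemma cnormB_ge x y : cnorm x <= cnorm (x - y) + cnorm y.
Proof. by apply: le_trans (cnormD _ _); rewrite subrK. Qed.

Lemma cnormS x : cnorm (star x) = cnorm x.
Proof.
suff le z : cnorm z <= cnorm (star z).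
  by apply/eqP; rewrite eq_le le -{2}[x]starK le.
have := cnormM (star z) z; rewrite cnorm_star.
have := cnorm_ge0 z; have := cnorm_ge0 (star z) => h1 h2 h.
have [->|z0] := eqVneq (cnorm z) 0 => //.
by rewrite expr2 ler_pM2r // lt_def z0 in h.
Qed.

Lemma cnorm1 : cnorm (1 : A) = 1.
Proof.
have := cnorm_star (1 : A); rewrite star1 mulr1 expr2 => h.
have h0 : cnorm (1 : A) != 0.
  by apply/eqP => /cnorm_eq0 /eqP; rewrite oner_eq0.
by apply: (mulfI h0); rewrite -h mulr1.
Qed.

Lemma cnorm_sa x : star x = x -> cnorm (x * x) = cnorm x ^+ 2.
Proof. by move=> h; rewrite -cnorm_star h. Qed.

Lemma star_mul_eq0 x : star x * x = 0 -> x = 0.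
Proof.
move=> h; apply: cnorm_eq0; apply/eqP.
by have /eqP := cnorm_star x; rewrite h cnorm0 eq_sym expf_eq0.
Qed.

Lemma cnorm_lt_eq0 x : (forall e, 0 < e -> cnorm x < e) -> x = 0.
Proof.
move=> h; apply: cnorm_eq0; apply/eqP; rewrite eq_le cnorm_ge0 andbT leNgt.
by apply/negP => /h; rewrite ltxx.
Qed.

Lemma mulr_dist (x y x' y' : A) :
  cnorm (x * y - x' * y') <=
  cnorm (x - x') * cnorm y + cnorm x' * cnorm (y - y').
Proof.
have -> : x * y - x' * y' = (x - x') * y + x' * (y - y').
  by rewrite mulrBl mulrBr addrA subrK.
by apply: le_trans (cnormD _ _) _; apply: lerD; apply: cnormM.
Qed.

Lemma norm_closed_sa : norm_closed [set x : A | star x = x].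
Proof.
move=> x h /=; apply/eqP; rewrite -subr_eq0; apply/eqP/cnorm_lt_eq0 => e e0.
have [|y /= ys xy] := h (e / 2); first by rewrite divr_gt0.
have -> : star x - x = star (x - y) + (y - x) by rewrite starB ys addrA subrK.
have := cnormD (star (x - y)) (y - x); rewrite cnormS (cnormBC y); lra.
Qed.

Lemma norm_closed_ball r : norm_closed [set x : A | cnorm x <= r].
Proof.
move=> x h /=; rewrite leNgt; apply/negP => rx.
have [|y /= yr xy] := h (cnorm x - r); first by rewrite subr_gt0.
by have := cnormB_ge x y; lra.
Qed.

Lemma norm_closed_comm z : norm_closed [set x : A | x * z = z * x].
Proof.
move=> x h /=; apply/eqP; rewrite -subr_eq0; apply/eqP/cnorm_lt_eq0 => e e0.
have z0 := cnorm_ge0 z.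
have k0 : 0 < 2 * (cnorm z + 1) by lra.
have [|y /= ys xy] := h (e / (2 * (cnorm z + 1))); first by rewrite divr_gt0.
have -> : x * z - z * x = (x * z - y * z) + (z * y - z * x).
  by rewrite ys addrA subrK.
apply: le_lt_trans (cnormD _ _) _; rewrite -mulrBl -mulrBr.
have h1 := cnormM (x - y) z; have h2 := cnormM z (y - x).
rewrite (cnormBC y) in h2.
rewrite ltr_pdivlMr // in xy; have := cnorm_ge0 (x - y); nra.
Qed.

Lemma star_subalgebra_comm z : star z = z ->
  star_subalgebra [set x : A | x * z = z * x].
Proof.
move=> zs; split=> [x y /= hx hy|t x /= hx|x y /= hx hy|x /= hx].
- by rewrite mulrDl mulrDr hx hy.
- by rewrite -scalerAl -scalerAr hx.
- by rewrite -mulrA hy mulrA hx mulrA.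
- by rewrite -{1}zs -starM -hx starM zs.
Qed.

(* [y] lies in the unital C*-algebra generated by [x]. *)
Definition cgen x y := forall S : set A,
  norm_closed S -> star_subalgebra S -> S 1 -> S x -> S y.

Lemma cgen_trans x y z : cgen x y -> cgen y z -> cgen x z.
Proof. by move=> xy yz S c s S1 Sx; apply: yz => //; apply: xy. Qed.

(** The commutant of a self-adjoint element is a closed star-subalgebra. This is how square roots,
    which are limits, inherit commutation relations without a functional calculus. *)
Lemma cgen_comm x y z : star z = z -> x * z = z * x -> cgen x y ->
  y * z = z * y.
Proof.
move=> zs xz xy; apply: (xy [set x : A | x * z = z * x]) => //.
- exact: norm_closed_comm.
- exact: star_subalgebra_comm.
- by rewrite /= mulr1 mul1r.
Qed.

Lemma star_subalgebraB (S : set A) x y : star_subalgebra S ->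
  S x -> S y -> S (x - y).
Proof.
move=> s Sx Sy; apply: star_subalgebraD => //.
by rewrite -scaleN1r; apply: star_subalgebraZ.
Qed.

End NormTheory.

(** * Square roots of elements near 1, by iteration *)

Section SquareRoot.
Variables (R : realType) (A : cstarAlgType R).
Implicit Types (x y z t : A).

(* The iteration converges to [1 - sqrt (1 - t)]; for the real number [t = 1]
   it dominates the one in a C*-algebra with [cnorm t <= 1]. *)
Fixpoint sqrt_iter t (n : nat) : A :=
  if n is n'.+1 then (2^-1)%:C%C *: (t + sqrt_iter t n' * sqrt_iter t n') else 0.

Fixpoint sqrt_maj (n : nat) : R :=
  if n is n'.+1 then 2^-1 * (1 + sqrt_maj n' ^+ 2) else 0.

(** The gap [d = 1 - sqrt_maj n] evolves by [d - d ^+ 2 / 2], the discrete analogue of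
    [d' = - d ^+ 2 / 2], whose solutions decay like [2 / n]. The explicit rate supplies the Cauchy
    modulus. *)
Lemma sqrt_maj_bound n :
  0 <= sqrt_maj n <= 1 /\ 1 - sqrt_maj n <= 2 / (n.+2)%:R.
Proof.
elim: n => [|n [/andP[h0 h1] h2]] /=; first by split; lra.
set q := sqrt_maj n in h0 h1 h2 *; split; first by apply/andP; split; nra.
have n0 : 0 < (n.+2)%:R :> R by rewrite ltr0n.
have n1 : 0 < (n.+3)%:R :> R by rewrite ltr0n.
have e : (n.+3)%:R = (n.+2)%:R + 1 :> R by rewrite -addn1 natrD.
rewrite ler_pdivlMr // in h2; rewrite ler_pdivlMr // e.
have m2 : 2 <= (n.+2)%:R :> R by rewrite ler_nat.
move: h2 m2; move: (_.+2%:R) => m hm m2.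
set d := 1 - q in hm.
have -> : (1 - 2^-1 * (1 + q ^+ 2)) = d - d ^+ 2 / 2 by rewrite /d; field.
have d0 : 0 <= d by rewrite /d; lra.
have d1 : d <= 1 by rewrite /d; lra.
(* Expanded, this product is [2 - (d - d ^+ 2 / 2) * (m + 1) - d ^+ 2 / 2], which is the induction
   step with room to spare. *)
have : 0 <= (2 - d * m) * (1 - d / 2) by apply: mulr_ge0; lra.
nra.
Qed.

Lemma sqrt_iter_bound t n : cnorm t <= 1 ->
  cnorm (sqrt_iter t n) <= sqrt_maj n /\
  cnorm (sqrt_iter t n.+1 - sqrt_iter t n) <= sqrt_maj n.+1 - sqrt_maj n.
Proof.
move=> t1; have h2 : `|2^-1| = 2^-1 :> R by rewrite ger0_norm // invr_ge0.
elim: n => [|n [IH1 IH2]].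
  rewrite /= cnorm0 mulr0 addr0 subr0 cnorm_scale h2 expr0n /= addr0 subr0; split=> //.
  by rewrite mulr1; lra.
have h : cnorm (sqrt_iter t n.+1) <= sqrt_maj n.+1.
  rewrite [sqrt_iter _ _]/= [sqrt_maj _]/= cnorm_scale h2 ler_pM2l ?invr_gt0 //.
  apply: le_trans (cnormD _ _) _; apply: lerD => //.
  by apply: le_trans (cnormM _ _) _; rewrite expr2; apply: ler_pM => //;
    apply: cnorm_ge0.
split=> //; set y := sqrt_iter t n in IH1 IH2; set y' := sqrt_iter t n.+1 in h IH2 *.
have -> : sqrt_iter t n.+2 = (2^-1)%:C%C *: (t + y' * y') by [].
have -> : sqrt_maj n.+2 = 2^-1 * (1 + sqrt_maj n.+1 ^+ 2) by [].
rewrite {2}/y' [sqrt_iter t n.+1]/= -/y -scalerBr opprD addrACA subrr add0r.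
rewrite {2}[sqrt_maj n.+1]/= -mulrBr cnorm_scale h2 ler_pM2l ?invr_gt0 //.
apply: le_trans (mulr_dist _ _ _ _) _.
move: (sqrt_maj n) (sqrt_maj n.+1) IH1 h IH2 => q q'.
have := cnorm_ge0 (y' - y); have := cnorm_ge0 y; have := cnorm_ge0 y'.
move=> b0 a0 c0 h3 h4 h5.
have p1 : cnorm (y' - y) * cnorm y' <= (q' - q) * q' by apply: ler_pM.
have p2 : cnorm y * cnorm (y' - y) <= q * (q' - q) by apply: ler_pM.
lra.
Qed.

Lemma sqrt_iter_dist t n m : cnorm t <= 1 -> (n <= m)%N ->
  cnorm (sqrt_iter t m - sqrt_iter t n) <= sqrt_maj m - sqrt_maj n.
Proof.
move=> t1; elim: m => [|m IH]; first by rewrite leqn0 => /eqP->; rewrite !subrr cnorm0.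
rewrite leq_eqVlt => /orP[/eqP->|/IH h]; first by rewrite !subrr cnorm0.
have [_ h'] := sqrt_iter_bound m t1.
by have := cnorm_dist (sqrt_iter t m.+1) (sqrt_iter t m) (sqrt_iter t n); lra.
Qed.

Lemma sqrt_iter_cvg t : cnorm t <= 1 -> exists l : A, forall e : R, 0 < e ->
  exists N : nat, forall n : nat, (N <= n)%N -> cnorm (sqrt_iter t n - l) < e.
Proof.
move=> t1; apply: cnorm_complete => e e0.
pose N := (Num.truncn (2 / e)).+1; exists N.
have key n m : (N <= n)%N -> (n <= m)%N ->
    cnorm (sqrt_iter t m - sqrt_iter t n) < e.
  move=> Nn nm; apply: le_lt_trans (sqrt_iter_dist t1 nm) _.
  have [/andP[_ m1] _] := sqrt_maj_bound m.
  have [_ nb] := sqrt_maj_bound n.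
  have h : 2 / (n.+2)%:R < e.
    rewrite ltr_pdivrMr ?ltr0n // mulrC -ltr_pdivrMr //.
    have : 2 / e < N%:R by rewrite /N truncnS_gt.
    move/lt_le_trans; apply; rewrite ler_nat; exact: leq_trans Nn (leqW (leqnSn _)).
  apply: le_lt_trans h; apply: le_trans nb; lra.
move=> m n Nm Nn; have [nm|/ltnW mn] := leqP n m; first exact: key.
by rewrite cnormBC key.
Qed.

(** With [t = 1 - x], the limit satisfies [2 l = t + l * l], so [(1 - l) * (1 - l) = 1 - t = x].
    Self-adjointness, the norm bound and membership in the generated algebra are closed conditions
    and pass from the iterates to [l]. *)
Lemma sqrt_exists x : star x = x -> cnorm (1 - x) <= 1 ->
  exists s, [/\ star s = s, s * s = x, cnorm (1 - s) <= 1 & cgen x s].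
Proof.
move=> xs x1; have [l hl] := sqrt_iter_cvg x1.
have inS (S : set A) : norm_closed S -> (forall n, S (sqrt_iter (1 - x) n)) -> S l.
  move=> cS hS; apply: cS => e e0; have [N hN] := hl e e0.
  by exists (sqrt_iter (1 - x) N) => //; rewrite cnormBC hN.
have ls : star l = l.
  apply: inS (@norm_closed_sa _ _) _; elim=> [|n] /=; first exact: star0.
  by move=> IH; rewrite star_scale starD starB starM IH star1 xs.
have l1 : cnorm l <= 1.
  apply: inS (@norm_closed_ball _ _ 1) _ => n /=.
  have [h _] := sqrt_iter_bound n x1.
  by have [/andP[_ h'] _] := sqrt_maj_bound n; apply: le_trans h h'.
have lfix : l = (2^-1)%:C%C *: (1 - x + l * l).
  apply/eqP; rewrite -subr_eq0; apply/eqP/cnorm_lt_eq0 => e e0.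
  have [|N hN] := hl (e / 2); first by rewrite divr_gt0.
  set y := sqrt_iter (1 - x) N.
  have h1 : cnorm (y - l) < e / 2 by apply: hN.
  have h2 : cnorm (sqrt_iter (1 - x) N.+1 - l) < e / 2 by apply: hN; apply: leqnSn.
  have h3 := cnorm_dist l (sqrt_iter (1 - x) N.+1) ((2^-1)%:C%C *: (1 - x + l * l)).
  apply: le_lt_trans h3 _; rewrite cnormBC.
  rewrite [X in _ + cnorm (X - _)]/= -/y -scalerBr opprD addrACA subrr add0r.
  rewrite cnorm_scale ger0_norm ?invr_ge0 //.
  have h4 := mulr_dist y y l l.
  have y1 : cnorm y <= 1.
    have [h _] := sqrt_iter_bound N x1.
    by have [/andP[_ h'] _] := sqrt_maj_bound N; apply: le_trans h h'.
  have := cnorm_ge0 (y - l); nra.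
have l2 : l + l = 1 - x + l * l.
  rewrite {1 2}lfix -scalerDl -rmorphD /= (_ : 2^-1 + 2^-1 = 1) ?scale1r //.
  lra.
exists (1 - l); split.
- by rewrite starB star1 ls.
- rewrite mulrBl mul1r mulrBr mulr1 opprB addrCA addrC.
  by rewrite -[1 - l - l]addrA -opprD l2 opprD addrA subrK opprB addrCA subrr addr0.
- by rewrite opprB addrCA subrr addr0.
move=> S cS sS S1 Sx; apply: star_subalgebraB => //.
apply: inS => //; elim=> [|n IH] /=.
  by rewrite -(scale0r x); apply: star_subalgebraZ.
apply: star_subalgebraZ => //; apply: star_subalgebraD => //.
  exact: star_subalgebraB.
exact: star_subalgebraM.
Qed.

End SquareRoot.

(** * The positive cone *)

Section Positive.
Variables (R : realType) (A : cstarAlgType R).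
Implicit Types (x y z : A) (c t : R).

(** For self-adjoint [x] the bound says that the spectrum lies in [[0, 2 t]]. In this form sums of
    positive elements are positive by the triangle inequality; the agreement with the form
    [star y * y] is the goal of this section. *)
Definition pos x := star x = x /\
  exists2 t : R, 0 <= t & cnorm (t%:C%C%:A - x) <= t.

Lemma pos_sa x : pos x -> star x = x. Proof. by case. Qed.

Lemma star_scalar c : star (c%:C%C%:A : A) = c%:C%C%:A.
Proof. by rewrite star_scale star1. Qed.

Lemma cnorm_scalar c : cnorm (c%:C%C%:A : A) = `|c|.
Proof. by rewrite cnorm_scale cnorm1 mulr1. Qed.

Lemma scale_half x : (2^-1)%:C%C *: (x + x) = x.
Proof.
by rewrite scalerDr -scalerDl -rmorphD /= (_ : 2^-1 + 2^-1 = 1) ?scale1r //; lra.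
Qed.

Lemma posD x y : pos x -> pos y -> pos (x + y).
Proof.
case=> xs [t t0 ht] [ys [t' t0' ht']]; split; first by rewrite starD xs ys.
exists (t + t'); first exact: addr_ge0.
by rewrite rmorphD scalerDl opprD addrACA; apply: le_trans (cnormD _ _) _; apply: lerD.
Qed.

Lemma posZ c x : 0 <= c -> pos x -> pos (c%:C%C *: x).
Proof.
move=> c0 [xs [t t0 ht]]; split; first by rewrite star_scale xs.
exists (c * t); first exact: mulr_ge0.
by rewrite rmorphM -scalerA -scalerBr cnorm_scale ger0_norm // ler_wpM2l.
Qed.

Lemma pos_scalarB c x : star x = x -> cnorm x <= c -> pos (c%:C%C%:A - x).
Proof.
move=> xs xc; split; first by rewrite starB star_scalar xs.
by exists c; [apply: le_trans xc; apply: cnorm_ge0|rewrite subKr].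
Qed.

Lemma pos_sqrt x : pos x ->
  exists s, [/\ star s = s, s * s = x, pos s & cgen x s].
Proof.
case=> xs [t t0 ht]; have [t00|tn0] := eqVneq t 0.
  rewrite t00 scale0r sub0r cnormN in ht.
  have -> : x = 0 by apply: cnorm_eq0; apply/eqP; rewrite eq_le ht cnorm_ge0.
  exists 0; split; rewrite ?star0 ?mulr0 //.
  by split; [exact: star0|exists 0; rewrite ?scale0r ?subr0 ?cnorm0].
have tgt0 : 0 < t by rewrite lt_def tn0.
have t'0 : 0 <= t^-1 by rewrite invr_ge0.
have [||s [ss s2 s1 sx]] := @sqrt_exists _ _ ((t^-1)%:C%C *: x).
- by rewrite star_scale xs.
- have -> : 1 = (t^-1)%:C%C *: t%:C%C%:A :> A by rewrite scalerA -rmorphM mulVf ?scale1r.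
  by rewrite -scalerBr cnorm_scale ger0_norm // mulrC ler_pdivrMr // mul1r.
have q0 := sqrtr_ge0 t.
exists ((Num.sqrt t)%:C%C *: s); split.
- by rewrite star_scale ss.
- rewrite -scalerAl -scalerAr scalerA -rmorphM /= -expr2 sqr_sqrtr // s2.
  by rewrite scalerA -rmorphM mulfV // scale1r.
- apply: posZ => //; split=> //; exists 1; first by [].
  by rewrite scale1r.
- move=> S cS sS S1 Sx; apply: star_subalgebraZ => //; apply: sx => //.
  exact: star_subalgebraZ.
Qed.

(* [y + i z] is [sqrt c] times a unitary. *)
Lemma cnorm_sq_le c y z : star y = y -> star z = z -> y * z = z * y ->
  0 <= c -> y * y + z * z = c%:C%C%:A -> cnorm (y * y) <= c.
Proof.
move=> ys zs yz c0 h; pose U := y + 'i%C *: z.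
have Us : star U = y - 'i%C *: z.
  rewrite starD starZ ys zs -scaleNr; congr (_ + _ *: _).
  by apply/eqP; rewrite eq_complex /= oppr0 !eqxx.
have UU : star U * U = c%:C%C%:A.
  rewrite Us mulrDr !mulrBl -!scalerAl -!scalerAr yz addrA subrK -h; congr (_ + _).
  rewrite scalerA -scaleNr -[RHS]scale1r; congr (_ *: _).
  by apply/eqP; rewrite eq_complex /= !mul0r !mulr0 !mulr1 !addr0 sub0r opprK oppr0 !eqxx.
have nU : cnorm U ^+ 2 = c by rewrite -cnorm_star UU cnorm_scalar ger0_norm.
have yU : y + y = U + star U by rewrite Us addrACA subrr addr0.
have : cnorm (y + y) <= cnorm U + cnorm U.
  by rewrite yU -{2}(cnormS U); apply: cnormD.
rewrite -(scale_half (y + y)) scalerDr scale_half.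
move=> h2; have h3 : cnorm y <= cnorm U.
  by rewrite -(scale_half y) cnorm_scale ger0_norm ?invr_ge0 //; lra.
by rewrite cnorm_sa // -nU ler_pXn2r // ?nnegrE ?cnorm_ge0.
Qed.

(** Take [c = cnorm (y * y)] and [z] the square root of [c - y * y]. It commutes with [y] and
    [z * z + y * y = c], so [cnorm_sq_le] bounds [c - y * y = z * z] by [c]. *)
Lemma pos_sq y : star y = y -> pos (y * y).
Proof.
move=> ys; have yys : star (y * y) = y * y by rewrite starM ys.
have [z [zs zz _ zg]] := pos_sqrt (pos_scalarB yys (lexx _)).
split=> //; exists (cnorm (y * y)); first exact: cnorm_ge0.
rewrite -zz; apply: (@cnorm_sq_le _ z y) => //; last by rewrite zz subrK.
  by apply: cgen_comm zg => //; rewrite mulrBl mulrBr mulr_algl mulr_algr mulrA.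
exact: cnorm_ge0.
Qed.

Lemma pos_comm_sqrt c x : pos x -> pos (c%:C%C%:A - x) ->
  exists y z, [/\ star y = y, star z = z, y * z = z * y, y * y = x
                & z * z = c%:C%C%:A - x].
Proof.
move=> px pcx; have [y [ys yy _ _]] := pos_sqrt px.
have [z [zs zz _ zg]] := pos_sqrt pcx.
exists y, z; split => //; apply/esym; apply: cgen_comm zg => //.
by rewrite mulrBl mulrBr mulr_algl mulr_algr -yy mulrA.
Qed.

Lemma pos_cnorm_le c x : 0 <= c -> pos x -> pos (c%:C%C%:A - x) -> cnorm x <= c.
Proof.
move=> c0 px pcx; have [y [z [ys zs yz yy zz]]] := pos_comm_sqrt px pcx.
by rewrite -yy; apply: (@cnorm_sq_le _ y z) => //; rewrite yy zz addrCA subrr addr0.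
Qed.

Lemma pos_cnormB c x : pos x -> cnorm x <= c -> cnorm (c%:C%C%:A - x) <= c.
Proof.
move=> px xc; have c0 := le_trans (cnorm_ge0 x) xc.
have pcx := pos_scalarB (pos_sa px) xc.
have [y [z [ys zs yz yy zz]]] := pos_comm_sqrt px pcx.
by rewrite -zz; apply: (@cnorm_sq_le _ z y) => //; rewrite yy zz subrK.
Qed.

Lemma pos_antisym x : pos x -> pos (- x) -> x = 0.
Proof.
move=> px pnx; apply: cnorm_eq0; apply/eqP; rewrite eq_le cnorm_ge0 andbT.
by apply: pos_cnorm_le => //; rewrite scale0r sub0r.
Qed.

Lemma pos_conj_sa x y : pos x -> star y = y -> x * y = y * x -> pos (y * x * y).
Proof.
move=> px ys xy; have [s [ss sx _ sg]] := pos_sqrt px.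
have -> : y * x * y = (y * s) * (y * s).
  by rewrite -sx -{2}(cgen_comm ys xy sg) !mulrA.
by apply: pos_sq; rewrite starM ys ss (cgen_comm ys xy sg).
Qed.

Lemma mul_addrr x y : (x + y) * (x + y) = x * x + y * y + (x * y + y * x).
Proof. by rewrite mulrDl !mulrDr (addrC (y * x)) addrACA. Qed.

(** With [a] and [b] twice the real and (up to sign) imaginary parts of [z], [a * a + b * b] is
    twice [z * star z + star z * z]. Hence [z * star z] is a sum of positive elements; no comparison
    of the spectra of the two products is required. *)
Lemma pos_mulC_star z : pos (- (star z * z)) -> pos (z * star z).
Proof.
move=> h; pose a := z + star z; pose b := 'i%C *: (z - star z).
have as_ : star a = a by rewrite starD starK addrC.
have bs : star b = b.
  rewrite starZ starB starK -[star z - z]opprB scalerN -scaleNr; congr (_ *: _).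
  by apply/eqP; rewrite eq_complex /= opprK oppr0 !eqxx.
have bb : b * b = - ((z - star z) * (z - star z)).
  rewrite -scalerAl -scalerAr scalerA -[in RHS]scaleN1r; congr (_ *: _).
  by apply/eqP; rewrite eq_complex /= !mul0r !mulr0 !mulr1 !addr0 sub0r oppr0 !eqxx.
have e : a * a + b * b = (z * star z + star z * z) + (z * star z + star z * z).
  have d : (z - star z) * (z - star z) =
      z * z + star z * star z - (z * star z + star z * z).
    by rewrite mul_addrr mulrNN mulrN mulNr -opprD.
  by rewrite bb d mul_addrr opprB addrC addrA subrK.
have -> : z * star z = (2^-1)%:C%C *: (a * a + b * b) - star z * z.
  by rewrite e scale_half addrK.
apply: posD => //; apply: posZ; first by rewrite invr_ge0.
by apply: posD; apply: pos_sq.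
Qed.


(* With [n = cnorm z ^+ 2] and [q = z * star z], the element
   [(n + q) * z = z * (n + star z * z)] has norm at most [n * cnorm z] because
   [star z * z] is negative, which is too small because [q] is positive. *)
Lemma pos_conj_eq0 z : pos (- (star z * z)) -> z = 0.
Proof.
move=> h; set q := z * star z; pose n := cnorm z ^+ 2.
have pq : pos q := pos_mulC_star h.
have qs := pos_sa pq.
have nq : cnorm q = n by rewrite /q -{1}(starK z) cnorm_star cnormS.
have n0 : 0 <= n by apply: sqr_ge0.
have n1 : cnorm (n%:C%C%:A + star z * z) <= n.
  by rewrite -[star z * z]opprK pos_cnormB // cnormN cnorm_star.
pose Y : A := n%:C%C%:A + q.
have Ys : star Y = Y by rewrite starD star_scalar qs.
have YZ : Y * z = z * (n%:C%C%:A + star z * z).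
  by rewrite mulrDl mulrDr mulr_algl mulr_algr mulrA.
have nYZ : cnorm (Y * q * Y) <= n ^+ 3.
  have -> : Y * q * Y = star (star (Y * z)) * star (Y * z).
    by rewrite starK starM Ys !mulrA.
  rewrite cnorm_star cnormS YZ; have h1 := cnormM z (n%:C%C%:A + star z * z).
  have h2 := le_trans h1 (ler_wpM2l (cnorm_ge0 z) n1).
  have -> : n ^+ 3 = (cnorm z * n) ^+ 2 by rewrite /n; ring.
  by rewrite ler_pXn2r // nnegrE ?mulr_ge0 // cnorm_ge0.
have E : Y * q * Y = (n ^+ 2)%:C%C *: q + q * q * q + (2 * n)%:C%C *: (q * q).
  rewrite /Y mulrDl mulr_algl mulrDr mulr_algr scalerDr scalerA.
  rewrite -rmorphM -expr2 mulrDl -scalerAl (addrC _ (q * q * q)) addrACA.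
  by rewrite -scalerDl -rmorphD /= (_ : n + n = 2 * n) //; ring.
(* Dropping the positive terms [n ^+ 2 q] and [q ^+ 3] from [Y * q * Y <= n ^+ 3] leaves
   [2 n q ^+ 2 <= n ^+ 3]. Since [q] has norm [n], taking norms gives [2 n ^+ 3 <= n ^+ 3]. *)
have pE : pos ((n ^+ 3)%:C%C%:A - (2 * n)%:C%C *: (q * q)).
  have -> : (n ^+ 3)%:C%C%:A - (2 * n)%:C%C *: (q * q) =
     ((n ^+ 3)%:C%C%:A - Y * q * Y) + ((n ^+ 2)%:C%C *: q + q * q * q).
    by rewrite E opprD -addrA addrAC addNr add0r.
  apply: posD; first by apply: pos_scalarB => //; rewrite starM (starM Y) Ys qs mulrA.
  apply: posD; first by apply: posZ => //; apply: sqr_ge0.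
  exact: pos_conj_sa.
have : cnorm ((2 * n)%:C%C *: (q * q)) <= n ^+ 3.
  apply: pos_cnorm_le => //; first exact: exprn_ge0.
  by apply: posZ; [apply: mulr_ge0|apply: pos_sq].
rewrite cnorm_scale cnorm_sa // nq ger0_norm; last by apply: mulr_ge0.
move=> h3.
have n3 : n ^+ 3 = 0.
  apply/eqP; rewrite eq_le exprn_ge0 // andbT.
  have := exprn_ge0 3 n0; move: h3; rewrite [2 * n * _](_ : _ = 2 * n ^+ 3); last by ring.
  lra.
by apply: cnorm_eq0; apply/eqP; move/eqP: n3; rewrite !expf_eq0 /=.
Qed.

(* With [h = p - m] the Jordan decomposition, [n = 2 m] and [k k = 4 m^3]. *)
Lemma negative_part x : star x = x -> exists n k,
  [/\ star n = n /\ star k = k, cgen x n, cgen x k, n * x * n = - (k * k)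
    & k = 0 -> pos x].
Proof.
move=> xs; have [g [gs gg pg gx]] := pos_sqrt (pos_sq xs).
have [r [rs rr _ rg]] := pos_sqrt pg.
have gx' : cgen x g by apply: cgen_trans gx => S _ sS _ Sx; apply: star_subalgebraM.
have gxC : g * x = x * g by apply: cgen_comm gx'.
have rxC : r * x = x * r by apply: cgen_comm rg.
have rgC : r * g = g * r by rewrite -rr mulrA.
pose n := g - x; have ns : star n = n by rewrite starB gs xs.
have rn : r * n = n * r by rewrite mulrBr mulrBl rgC rxC.
have gn : g * n = n * g by rewrite mulrBr mulrBl gxC.
have xn : n * x = - (g * n) by rewrite mulrBl mulrBr gg opprB gxC.
have kk : (r * n) * (r * n) = g * n * n by rewrite -mulrA (mulrA n) -rn !mulrA rr.
have nx : cgen x n.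
  by move=> S cS sS S1 Sx; apply: star_subalgebraB => //; apply: gx'.
exists n, (r * n); split=> //.
- by rewrite starM rs ns rn.
- move=> S cS sS S1 Sx; apply: star_subalgebraM => //; last exact: nx.
  by apply: (cgen_trans gx' rg).
- by rewrite xn kk mulNr.
move=> k0; have gnn : g * n * n = 0 by rewrite -kk k0 mulr0.
(* [n * x = - (g * n)] gives [n * n = 2 g * n], so [n ^+ 3 = 2 g * n * n = 0]. A nilpotent
   self-adjoint element vanishes, which leaves [x = g], the positive square root of [x * x]. *)
have n3 : n * n * n = 0.
  have -> : n * n = g * n - n * x by rewrite gn -mulrBr.
  by rewrite xn opprK mulrDl gnn addr0.
have n2 : n * n = 0 by apply: star_mul_eq0; rewrite starM ns mulrA n3 mul0r.
have n0 : n = 0 by apply: star_mul_eq0; rewrite ns.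
by rewrite -(subrK x g) -/n n0 add0r in pg.
Qed.

(** For [n] and [k] attached to [star x * x], [star (x * n) * (x * n) = - (k * k)] is negative, so
    [x * n = 0] by [pos_conj_eq0]. Then [k = 0], that is, there is no negative part. *)
Lemma pos_star_mul x : pos (star x * x).
Proof.
have xs : star (star x * x) = star x * x by rewrite starM starK.
have [n [k [[ns ks] _ _ e h]]] := negative_part xs; apply: h.
have e' : star (x * n) * (x * n) = - (k * k) by rewrite -e starM ns !mulrA.
have xn : x * n = 0 by apply: pos_conj_eq0; rewrite e' opprK; apply: pos_sq.
by apply: star_mul_eq0; rewrite ks -[k * k]opprK -e' xn mulr0 oppr0.
Qed.

Lemma pos_conj x y : pos x -> pos (star y * x * y).
Proof.
move=> px; have [s [ss sx _ _]] := pos_sqrt px.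
rewrite -sx (_ : _ * y = star (s * y) * (s * y)); first exact: pos_star_mul.
by rewrite starM ss !mulrA.
Qed.

Lemma norm_closed_pos : norm_closed [set x : A | pos x].
Proof.
move=> x hx; split.
  by apply: norm_closed_sa => e /hx [y /pos_sa ys xy]; exists y.
exists (cnorm x); first exact: cnorm_ge0.
rewrite leNgt; apply/negP => lt.
(* Replacing [x] by [y] costs three errors: in the scalar, in the element and in the bound
   [cnorm y]. A quarter of the gap for each keeps the contradiction strict. *)
have [|y py xy] := hx ((cnorm ((cnorm x)%:C%C%:A - x) - cnorm x) / 4).
  by rewrite divr_gt0 // subr_gt0.
have h1 := pos_cnormB py (lexx _).
have h2 := cnorm_dist ((cnorm x)%:C%C%:A) ((cnorm y)%:C%C%:A) x.
have h3 := cnorm_dist ((cnorm y)%:C%C%:A) y x.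
have h4 : cnorm ((cnorm x)%:C%C%:A - (cnorm y)%:C%C%:A : A) <= cnorm (x - y).
  rewrite -scalerBl -rmorphB /= cnorm_scalar ler_norml.
  by have := cnormB_ge x y; have := cnormB_ge y x; rewrite (cnormBC y); lra.
have := cnormB_ge y x; rewrite (cnormBC y x) in h3 *; lra.
Qed.

End Positive.

Section Homomorphism.
Variables (R : realType) (A B : cstarAlgType R) (f : {starhom A -> B}).

Lemma starhom_pos x : pos x -> pos (f x).
Proof.
by case/pos_sqrt => s [ss <- _ _]; rewrite -{1}ss rmorphM /= star_morph; apply: pos_star_mul.
Qed.

(** If [k] comes from the negative part of [x], then [- (f k * f k)] is a conjugate of the positive
    [f x], while [f k * f k] is positive. So [f k = 0], and injectivity removes [k]. *)
Lemma starhom_pos_inj x : injective f -> pos (f x) -> pos x.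
Proof.
move=> fi pfx; have xs : star x = x by apply: fi; rewrite star_morph pos_sa.
have [n [k [[ns ks] _ _ e h]]] := negative_part xs; apply: h.
have e' : star (f n) * f x * f n = - (f k * f k).
  by rewrite -star_morph ns -!rmorphM e rmorphN.
have pk : pos (f k * f k) by apply: pos_sq; rewrite -star_morph ks.
have fk : f k * f k = 0.
  by apply: pos_antisym => //; rewrite -e'; apply: pos_conj.
by apply: star_mul_eq0; apply: fi; rewrite ks rmorphM fk raddf0.
Qed.

End Homomorphism.

(** * Conditional expectations and graphs of partial isomorphisms *)

Section Continuity.
Variables (R : realType) (A : cstarAlgType R).

Lemma mulr_near (x y : A) (e : R) : 0 < e -> exists2 d : R, 0 < d &
  forall x' y', cnorm (x - x') < d -> cnorm (y - y') < d ->
    cnorm (x * y - x' * y') < e.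
Proof.
move=> e0; have x0 := cnorm_ge0 x; have y0 := cnorm_ge0 y.
pose K := cnorm x + cnorm y + 1; have K0 : 0 < K by rewrite /K; lra.
exists (Num.min 1 (e / K)); first by rewrite lt_min ltr01 divr_gt0.
move=> x' y'; rewrite !lt_min !ltr_pdivlMr // => /andP[h1 h2] /andP[h3 h4].
have h5 := mulr_dist x y x' y'; have h6 := cnormB_ge x' x.
rewrite cnormBC in h6.
have := cnorm_ge0 (x - x'); have := cnorm_ge0 (y - y').
have p : cnorm x' * cnorm (y - y') <= (1 + cnorm x) * cnorm (y - y').
  by apply: ler_wpM2r; [exact: cnorm_ge0|lra].
move=> b0 a0; apply: le_lt_trans (le_trans h5 _) _; first exact: lerD (lexx _) p.
have [ab|ba] := leP (cnorm (x - x')) (cnorm (y - y')).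
  apply: le_lt_trans h4; rewrite /K [leRHS](_ : _ =
    cnorm (y - y') * cnorm y + (1 + cnorm x) * cnorm (y - y')); last by ring.
  by rewrite lerD2r ler_wpM2r.
apply: le_lt_trans h2; rewrite /K [leRHS](_ : _ =
  cnorm (x - x') * cnorm y + (1 + cnorm x) * cnorm (x - x')); last by ring.
by rewrite lerD2l ler_wpM2l ?ltW //; lra.
Qed.

Lemma scaler_near (z : R[i]) (x : A) (e : R) : 0 < e -> exists2 d : R, 0 < d &
  forall x', cnorm (x - x') < d -> cnorm (z *: x - z *: x') < e.
Proof.
move=> e0; have z0 : 0 <= ComplexField.Normc.normc z by case: (z) => a b /=; exact: sqrtr_ge0.
exists (e / (ComplexField.Normc.normc z + 1)); first by rewrite divr_gt0 //; lra.
move=> x'; rewrite ltr_pdivlMr; last lra.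
rewrite -scalerBr cnormZ => h; apply: le_lt_trans h; rewrite mulrC.
by apply: ler_wpM2l; [exact: cnorm_ge0|lra].
Qed.

End Continuity.

Section CondExp.
Variables (R : realType) (A : cstarAlgType R) (D : set A) (E : A -> A).
Hypothesis ceE : cond_exp D E.

Lemma ceD x y : E (x + y) = E x + E y.
Proof. by have := cond_exp_linear ceE 1 x y; rewrite !scale1r. Qed.

Lemma ce0 : E 0 = 0.
Proof. by apply: (addrI (E 0)); rewrite -ceD !addr0. Qed.

Lemma ceZ z x : E (z *: x) = z *: E x.
Proof. by have := cond_exp_linear ceE z x 0; rewrite ce0 !addr0. Qed.

Lemma ceN x : E (- x) = - E x.
Proof. by rewrite -scaleN1r ceZ scaleN1r. Qed.

Lemma ceB x y : E (x - y) = E x - E y.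
Proof. by rewrite ceD ceN. Qed.

Lemma ce_sum I (r : seq I) (F : I -> A) :
  E (\sum_(i <- r) F i) = \sum_(i <- r) E (F i).
Proof. exact: (big_morph E ceD ce0). Qed.

Lemma ce_pos x : pos x -> pos (E x).
Proof.
case/pos_sqrt => s [ss <- _ _]; have [y] := cond_exp_positive ceE s.
by rewrite ss => ->; apply: pos_star_mul.
Qed.

(* By the parallelogram law, [E (star (x + y) * (x + y))] is the negative of a
   positive element. *)
Lemma ce_nullD x y : E (star x * x) = 0 -> E (star y * y) = 0 ->
  E (star (x + y) * (x + y)) = 0.
Proof.
move=> x0 y0; apply: pos_antisym; first by apply: ce_pos; apply: pos_star_mul.
suff -> : - E (star (x + y) * (x + y)) = E (star (x - y) * (x - y)).
  by apply: ce_pos; apply: pos_star_mul.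
rewrite starD starB !mulrDl !mulrDr !mulrN !mulNr !(ceD, ceN) opprK x0 y0.
by rewrite !add0r !addr0 opprD.
Qed.

Lemma ce_null_sum I (r : seq I) (F : I -> A) :
  (forall i, E (star (F i) * F i) = 0) ->
  E (star (\sum_(i <- r) F i) * \sum_(i <- r) F i) = 0.
Proof.
move=> h; elim/big_ind: _ => //; first by rewrite mulr0 ce0.
exact: ce_nullD.
Qed.

Lemma ce_null_mulr x d : D d -> D (star d) -> E (star x * x) = 0 ->
  E (star (x * d) * (x * d)) = 0.
Proof.
move=> Dd Dd' h; rewrite starM -mulrA (mulrA (star x)) mulrA.
by rewrite (cond_exp_bimodule ceE) // h mulr0 mul0r.
Qed.

End CondExp.

(** * Relations closed under the algebra operations, and their closures *)

Section Graph.
Variables (R : realType) (A1 A2 : cstarAlgType R).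

(** A relation and not a map: two polynomials could take the same value on one side only, and this
    is excluded only once norms have been compared. *)
Record graph_algebra (G : A1 -> A2 -> Prop) : Prop := {
  graph1 : G 1 1;
  graphD : forall x y x' y', G x y -> G x' y' -> G (x + x') (y + y');
  graphZ : forall (z : R[i]) x y, G x y -> G (z *: x) (z *: y);
  graphM : forall x y x' y', G x y -> G x' y' -> G (x * x') (y * y');
  graph_star : forall x y, G x y -> G (star x) (star y)
}.

Variable G : A1 -> A2 -> Prop.
Hypothesis aG : graph_algebra G.

Lemma graphN x y : G x y -> G (- x) (- y).
Proof. by move=> h; rewrite -(scaleN1r x) -(scaleN1r y); apply: graphZ. Qed.

Lemma graphB x y x' y' : G x y -> G x' y' -> G (x - x') (y - y').
Proof. by move=> h h'; apply: graphD => //; apply: graphN. Qed.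

Definition graph_closure (x : A1) (y : A2) := forall e : R, 0 < e ->
  exists x' y', [/\ G x' y', cnorm (x - x') < e & cnorm (y - y') < e].

Lemma graph_closure_sub x y : G x y -> graph_closure x y.
Proof. by move=> h e e0; exists x, y; rewrite !subrr !cnorm0. Qed.

Lemma graph_algebra_closure : graph_algebra graph_closure.
Proof.
split=> [|x y x' y' h h' e e0|z x y h e e0|x y x' y' h h' e e0|x y h e e0].
- by apply: graph_closure_sub; apply: graph1.
- have e2 : 0 < e / 2 by rewrite divr_gt0.
  have [x1 [y1 [g h1 h2]]] := h _ e2.
  have [x2 [y2 [g' h3 h4]]] := h' _ e2.
  exists (x1 + x2), (y1 + y2); rewrite !opprD !(addrACA _ _ (- _)); split.
  + exact: graphD.
  + by apply: le_lt_trans (cnormD _ _) _; lra.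
  + by apply: le_lt_trans (cnormD _ _) _; lra.
- have [d1 d10 hd1] := scaler_near z x e0.
  have [d2 d20 hd2] := scaler_near z y e0.
  have [|x1 [y1 [g h1 h2]]] := h (Num.min d1 d2); first by rewrite lt_min d10.
  move: h1 h2; rewrite !lt_min => /andP[h1 _] /andP[_ h2].
  by exists (z *: x1), (z *: y1); split; [apply: graphZ|apply: hd1|apply: hd2].
- have [d1 d10 hd1] := mulr_near x x' e0.
  have [d2 d20 hd2] := mulr_near y y' e0.
  have d0 : 0 < Num.min d1 d2 by rewrite lt_min d10.
  have [x1 [y1 [g]]] := h _ d0; have [x2 [y2 [g']]] := h' _ d0.
  rewrite !lt_min => /andP[h1 _] /andP[_ h2] /andP[h3 _] /andP[_ h4].
  by exists (x1 * x2), (y1 * y2); split; [apply: graphM|apply: hd1|apply: hd2].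
- have [x1 [y1 [g h1 h2]]] := h e e0; exists (star x1), (star y1).
  by rewrite -!starB !cnormS; split=> //; apply: graph_star.
Qed.

Definition graph_range : set A2 := [set y | forall e : R, 0 < e ->
  exists x y', G x y' /\ cnorm (y - y') < e].

Lemma graph_rangeI x y : G x y -> graph_range y.
Proof. by move=> g e e0; exists x, y; rewrite subrr cnorm0. Qed.

Lemma norm_closed_graph_range : norm_closed graph_range.
Proof.
move=> y h e e0; have e2 : 0 < e / 2 by rewrite divr_gt0.
have [y1 S1 h1] := h _ e2; have [x2 [y2 [g h2]]] := S1 _ e2.
by exists x2, y2; split=> //; have := cnorm_dist y y1 y2; lra.
Qed.

End Graph.

Section GraphRange.
Variables (R : realType) (A1 A2 : cstarAlgType R) (G : A1 -> A2 -> Prop).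
Hypothesis aG : graph_algebra G.

(** The identity relation on the second projection of [G] is a graph algebra on [A2], and its
    closure meets the diagonal in [graph_range G]. The continuity estimates of
    [graph_algebra_closure] are thus reused. *)
Lemma star_subalgebra_graph_range : star_subalgebra (graph_range G).
Proof.
pose Gd (y y' : A2) := y = y' /\ exists x, G x y.
have aGd : graph_algebra Gd.
  split; first by split=> //; exists 1; apply: graph1.
  - move=> _ x _ x' [-> [y g]] [-> [y' g']]; split=> //.
    by exists (y + y'); apply: (graphD aG).
  - by move=> z _ x [-> [y g]]; split=> //; exists (z *: y); apply: graphZ.
  - move=> _ x _ x' [-> [y g]] [-> [y' g']]; split=> //.
    by exists (y * y'); apply: (graphM aG).
  - by move=> _ x [-> [y g]]; split=> //; exists (star y); apply: graph_star.
have eqS y : graph_range G y <-> graph_closure Gd y y.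
  split=> [h e /h [x [y' [g hy]]]|h e /h [y' [_ [[<- [x g]] hy _]]]].
    by exists y', y'; split=> //; split=> //; exists x.
  by exists x, y'.
have aC := graph_algebra_closure aGd.
split=> [x y /eqS hx /eqS hy|z x /eqS hx|x y /eqS hx /eqS hy|x /eqS hx].
- by apply/eqS; apply: (graphD aC).
- by apply/eqS; apply: (graphZ aC).
- by apply/eqS; apply: (graphM aC).
- by apply/eqS; apply: (graph_star aC).
Qed.

End GraphRange.

Section IsometricGraph.
Variables (R : realType) (A1 A2 : cstarAlgType R) (G : A1 -> A2 -> Prop).
Hypothesis aG : graph_algebra G.
Hypothesis isoG : forall x y, G x y -> cnorm x = cnorm y.

Lemma cnorm_graph_closure x y : graph_closure G x y -> cnorm x = cnorm y.
Proof.
move=> h; apply/eqP; rewrite eq_le !leNgt; apply/andP; split; apply/negP => lt.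
  have [|x' [y' [/isoG g h1 h2]]] := h ((cnorm x - cnorm y) / 2).
    by rewrite divr_gt0 // subr_gt0.
  by have := cnormB_ge x x'; have := cnormB_ge y' y; rewrite (cnormBC y'); lra.
have [|x' [y' [/isoG g h1 h2]]] := h ((cnorm y - cnorm x) / 2).
  by rewrite divr_gt0 // subr_gt0.
by have := cnormB_ge y y'; have := cnormB_ge x' x; rewrite (cnormBC x'); lra.
Qed.

(** Approximate [x] by elements having partners. Isometry, applied to differences, makes the
    partners a Cauchy sequence, and completeness of [A2] yields the limit. *)
Lemma graph_closure_total x : graph_range (fun y x => G x y) x ->
  exists y, graph_closure G x y.
Proof.
move=> h; have n0 n : 0 < (n.+1)%:R^-1 :> R by rewrite invr_gt0 ltr0n.
have /choice[s hs] n : exists p : A1 * A2,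
    G p.1 p.2 /\ cnorm (x - p.1) < (n.+1)%:R^-1.
  by have [y' [x' [g hx]]] := h _ (n0 n); exists (x', y').
have small (e : R) : 0 < e -> exists N : nat, forall n, (N <= n)%N ->
    (n.+1)%:R^-1 < e.
  move=> e0; exists (Num.truncn e^-1) => n Nn.
  rewrite invf_plt ?posrE ?ltr0n //.
  have : e^-1 < (Num.truncn e^-1).+1%:R by rewrite truncnS_gt.
  by move/lt_le_trans; apply; rewrite ler_nat ltnS.
have [e e0|y hy] := @cnorm_complete _ A2 (fun n => (s n).2).
  have [N hN] := small (e / 2) (divr_gt0 e0 (ltr0Sn R 1)); exists N => m n Nm Nn.
  have [gm xm] := hs m; have [gn xn] := hs n.
  rewrite -(isoG (graphB aG gm gn)).
  have := hN _ Nm; have := hN _ Nn; have := cnorm_dist (s m).1 x (s n).1.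
  rewrite (cnormBC _ x) => h1 h2 h3; apply: le_lt_trans h1 _.
  by rewrite [e]splitr ltrD //; [apply: lt_trans xm h3|apply: lt_trans xn h2].
exists y => e e0; have [N hN] := small e e0; have [M hM] := hy e e0.
have [g xn] := hs (maxn N M); exists (s (maxn N M)).1, (s (maxn N M)).2; split=> //.
  by apply: lt_trans xn _; apply: hN; apply: leq_maxl.
by rewrite cnormBC; apply: hM; apply: leq_maxr.
Qed.

Lemma graph_closure_injl x x' y : graph_closure G x y -> graph_closure G x' y -> x = x'.
Proof.
move=> g g'; have := cnorm_graph_closure (graphB (graph_algebra_closure aG) g g').
rewrite subrr cnorm0 => /cnorm_eq0 /eqP; rewrite subr_eq0; exact: eqP.
Qed.

Lemma graph_closure_injr x y y' : graph_closure G x y -> graph_closure G x y' -> y = y'.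
Proof.
move=> g g'; have := cnorm_graph_closure (graphB (graph_algebra_closure aG) g g').
rewrite subrr cnorm0 => /esym /cnorm_eq0 /eqP; rewrite subr_eq0; exact: eqP.
Qed.

End IsometricGraph.

Lemma graph_closure_flip (R : realType) (A1 A2 : cstarAlgType R)
    (G : A1 -> A2 -> Prop) x y :
  graph_closure (fun y x => G x y) y x -> graph_closure G x y.
Proof. by move=> h e /h [y' [x' [g hy hx]]]; exists x', y'. Qed.

(** * Positivity and norms transferred through compatible conditional expectations *)

Section Transfer.
Variables (R : realType) (A1 A2 B : cstarAlgType R).
Variables (j1 : {starhom B -> A1}) (j2 : {starhom B -> A2}).
Variables (D1 : set A1) (D2 : set A2) (E1 : A1 -> A1) (E2 : A2 -> A2).
Variables (G : A1 -> A2 -> Prop).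
Local Notation S := (graph_range G).
Hypotheses (j1i : injective j1).
Hypotheses (ce1 : cond_exp D1 E1) (ce2 : cond_exp D2 E2).
Hypothesis aG : graph_algebra G.
Hypothesis GE : forall x y, G x y -> exists2 b, E1 x = j1 b & E2 y = j2 b.
Hypothesis ndS : forall d, S d ->
  (forall y, S y -> E2 (star y * star d * d * y) = 0) -> d = 0.

(** For a vector with partner [x'], [E1 (star x' * x * x')] is a positive [j1 b]; injectivity of
    [j1] makes [b] positive, hence also [j2 b], the corresponding value of [E2]. Density extends
    this to vectors of [S], and [n], [k] stay in [S] because [y] generates them; so [ndS] can be
    applied to [k]. *)
Lemma transfer_pos x y : G x y -> star y = y -> pos x -> pos y.
Proof.
move=> g ys px.
have dense z : S z -> pos (E2 (star z * y * z)).
  move=> Sz; apply: norm_closed_pos => e e0.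
  have [d d0 hd] := mulr_near (star z) (y * z) e0.
  have [d' d'0 hd'] := mulr_near y z d0.
  have [|x' [z' [g' zz']]] := Sz (Num.min d d').
    by rewrite lt_min d0.
  move: zz'; rewrite lt_min => /andP[zd zd'].
  exists (E2 (star z' * y * z')) => /=.
    have [b e1 e2] := GE (graphM aG (graphM aG (graph_star aG g') g) g').
    rewrite e2; apply: starhom_pos; apply: (starhom_pos_inj j1i).
    by rewrite -e1; apply: (ce_pos ce1); apply: pos_conj.
  rewrite -(ceB ce2); apply: le_lt_trans (cond_exp_contractive ce2 _) _.
  rewrite -!mulrA; apply: hd; first by rewrite -starB cnormS.
  by apply: hd' => //; rewrite subrr cnorm0.
have [n [k [[ns ks] gn gk e h]]] := negative_part ys.
have S1 : S 1 by apply: graph_rangeI (graph1 aG).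
have clS := @norm_closed_graph_range _ _ _ G.
have sS := star_subalgebra_graph_range aG.
have Sn : S n by apply: gn => //; apply: graph_rangeI g.
have Sk : S k by apply: gk => //; apply: graph_rangeI g.
apply: h; apply: ndS => // z Sz; rewrite ks.
have -> : star z * k * k * z = star (k * z) * (k * z) by rewrite starM ks !mulrA.
apply: pos_antisym; first by apply: (ce_pos ce2); apply: pos_star_mul.
rewrite -(ceN ce2) (_ : - _ = star (n * z) * y * (n * z)).
  by apply: dense; apply: (star_subalgebraM sS).
rewrite !starM ns ks -!mulrA -mulrN; congr (_ * _).
by rewrite !mulrA -mulNr -e.
Qed.

(** [cnorm x ^+ 2 - star x * x] is positive and its partner is [cnorm x ^+ 2 - star y * y]. *)
Lemma transfer_cnorm_le x y : G x y -> cnorm y <= cnorm x.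
Proof.
move=> g; have gs := graphM aG (graph_star aG g) g.
have x0 := sqr_ge0 (cnorm x).
rewrite -(ler_pXn2r (ltn0Sn 1)) ?nnegrE ?cnorm_ge0 // -[X in X <= _]cnorm_star.
have ysa : star (star y * y) = star y * y by rewrite starM starK.
apply: pos_cnorm_le => //; first exact: pos_star_mul.
apply: (transfer_pos (graphB aG (graphZ aG (cnorm x ^+ 2)%:C%C (graph1 aG)) gs)).
  by rewrite starB star_scalar ysa.
apply: pos_scalarB; first by rewrite starM starK.
by rewrite cnorm_star.
Qed.

End Transfer.

(** * Reduction of words in an HNN extension *)

Section HNNGraph.
Variables (R : realType) (B C A1 A2 : cstarAlgType R).
Variables (iC theta : {starhom C -> B}) (EC Etheta : B -> B).
Hypotheses (ceC : cond_exp (range iC) EC) (ceT : cond_exp (range theta) Etheta).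
Variables (j1 : {starhom B -> A1}) (j2 : {starhom B -> A2}).
Variables (u1 : A1) (u2 : A2).

(** Pairs of values of one and the same noncommutative polynomial. Both exponents of the unitary are
    generators, so stability under [star] is derived. *)
Inductive hnn_graph : A1 -> A2 -> Prop :=
| hnn_graph_base b : hnn_graph (j1 b) (j2 b)
| hnn_graph_upow e : hnn_graph (upow u1 e) (upow u2 e)
| hnn_graph_add x y x' y' :
    hnn_graph x y -> hnn_graph x' y' -> hnn_graph (x + x') (y + y')
| hnn_graph_scale (z : R[i]) x y : hnn_graph x y -> hnn_graph (z *: x) (z *: y)
| hnn_graph_mul x y x' y' :
    hnn_graph x y -> hnn_graph x' y' -> hnn_graph (x * x') (y * y').

Lemma hnn_graph_algebra : graph_algebra hnn_graph.
Proof.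
split; [|exact: hnn_graph_add|exact: hnn_graph_scale|exact: hnn_graph_mul|].
  by rewrite -(rmorph1 j1) -(rmorph1 j2); apply: hnn_graph_base.
move=> x y; elim=> {x y} [b|e|x y x' y' _ IH _ IH'|z x y _ IH|x y x' y' _ IH _ IH'].
- by rewrite -!star_morph; apply: hnn_graph_base.
- have -> : star (upow u1 e) = upow u1 (~~ e) by case: e => //=; rewrite starK.
  have -> : star (upow u2 e) = upow u2 (~~ e) by case: e => //=; rewrite starK.
  exact: hnn_graph_upow.
- by rewrite !starD; apply: hnn_graph_add.
- by rewrite !starZ; apply: hnn_graph_scale.
- by rewrite !starM; apply: hnn_graph_mul.
Qed.

(** The flanking elements of [B] come out of the conditional expectation by bimodularity, and they
    absorb scalars. *)
Inductive reduced_span : A1 -> A2 -> Prop :=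
| reduced_span_base b : reduced_span (j1 b) (j2 b)
| reduced_span_word b e s b' : reduced EC Etheta e s ->
    reduced_span (j1 b * word j1 u1 e s * j1 b') (j2 b * word j2 u2 e s * j2 b')
| reduced_span_add x y x' y' :
    reduced_span x y -> reduced_span x' y' -> reduced_span (x + x') (y + y').

Hypotheses (u1l : star u1 * u1 = 1) (u1r : u1 * star u1 = 1).
Hypotheses (u2l : star u2 * u2 = 1) (u2r : u2 * star u2 = 1).
Hypothesis cov1 : forall c, u1 * j1 (theta c) * star u1 = j1 (iC c).
Hypothesis cov2 : forall c, u2 * j2 (theta c) * star u2 = j2 (iC c).

Lemma reduced_spanZ (z : R[i]) x y : reduced_span x y -> reduced_span (z *: x) (z *: y).
Proof.
elim=> {x y} [b|b e s b' h|x y x' y' _ IH _ IH'].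
- by rewrite -!linearZ; apply: reduced_span_base.
- by rewrite !scalerAl -!linearZ; apply: reduced_span_word.
- by rewrite !scalerDr; apply: reduced_span_add.
Qed.

Lemma reduced_span_mul_base b x y :
  reduced_span x y -> reduced_span (j1 b * x) (j2 b * y).
Proof.
elim=> {x y} [b'|b' e s b'' h|x y x' y' _ IH _ IH'].
- by rewrite -!rmorphM; apply: reduced_span_base.
- by rewrite !mulrA -!rmorphM; apply: reduced_span_word.
- by rewrite !mulrDr; apply: reduced_span_add.
Qed.

Lemma upow_conj (A : cstarAlgType R) (j : {starhom B -> A}) (u : A) :
  star u * u = 1 -> (forall c, u * j (theta c) * star u = j (iC c)) ->
  (forall c, upow u true * j (theta c) * upow u false = j (iC c)) /\
  (forall c, upow u false * j (iC c) * upow u true = j (theta c)).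
Proof.
move=> ul cov; split=> c /=; first exact: cov.
by rewrite -cov !mulrA ul mul1r -mulrA ul mulr1.
Qed.

(* A non-reduced product [u^e b u^-e] is reduced to a shorter one by splitting
   [b] as [(b - E b) + E b] and moving [E b] across with the covariance relation. *)
Lemma reduced_span_mul_upow e x y :
  reduced_span x y -> reduced_span (upow u1 e * x) (upow u2 e * y).
Proof.
have [cv1 cv1'] := upow_conj u1l cov1; have [cv2 cv2'] := upow_conj u2l cov2.
elim=> {x y} [b'|b e' s b' h|x y x' y' _ IH _ IH'].
- rewrite -(mul1r (upow u1 e)) -(rmorph1 j1) -(mul1r (upow u2 e)) -(rmorph1 j2).
  exact: (@reduced_span_word 1 e [::]).
- have [ee|ee] := eqVneq e e'.
    have := @reduced_span_word 1 e ((b, e') :: s) b'.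
    by rewrite /= !rmorph1 !mul1r !mulrA; apply; rewrite -ee in h *; split=> // ->.
  pose Ee := if e then Etheta else EC.
  pose D := if e then range theta else range iC.
  have ce : cond_exp D Ee by rewrite /D /Ee; case: (e).
  have [b'' h1 h2] : exists2 b'', upow u1 e * j1 (Ee b) * upow u1 e' = j1 b'' &
      upow u2 e * j2 (Ee b) * upow u2 e' = j2 b''.
    have := cond_exp_range ce b; move: ee; rewrite /D /Ee.
    by case: (e); case: (e') => // _ [c _ <-]; eexists; eauto.
  rewrite -(subrK (Ee b) b) (raddfD j1 (b - Ee b)) (raddfD j2 (b - Ee b)) /=.
  rewrite !mulrDl !mulrDr; apply: reduced_span_add.
    have E0 : Ee (b - Ee b) = 0.
      by rewrite (ceB ce) (cond_exp_id ce (cond_exp_range ce b)) subrr.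
    have := @reduced_span_word 1 e ((b - Ee b, e') :: s) b'.
    rewrite /= !rmorph1 !mul1r !mulrA; apply.
    by split=> //; move: ee E0; rewrite /Ee; case: (e); case: (e').
  (* After the cancellation the element [b''] either merges with [b'] into the base, or with [b1]
     into the left flank of a shorter word, whose reducedness is inherited. *)
  case: s h => [|[b1 e1] s] /= h.
    by rewrite !mulrA h1 h2 -!rmorphM; apply: reduced_span_base.
  rewrite !mulrA h1 h2 -!rmorphM; apply: reduced_span_word.
  by case: h.
- by rewrite !mulrDr; apply: reduced_span_add.
Qed.

Lemma hnn_graph_reduced x y : hnn_graph x y -> reduced_span x y.
Proof.
(* The factor 1 is generalized to any pair in [reduced_span]: the induction shows stability under
   left multiplication, so two reduced words never have to be multiplied together. *)
move=> g; rewrite -(mulr1 x) -(mulr1 y).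
have : reduced_span 1 1.
  by rewrite -(rmorph1 j1) -(rmorph1 j2); apply: reduced_span_base.
elim: g (1 : A1) (1 : A2) => {x y} [b|e|x y x' y' _ IH _ IH'|z x y _ IH|x y x' y' _ IH _ IH'] p q r.
- exact: reduced_span_mul_base.
- exact: reduced_span_mul_upow.
- by rewrite !mulrDl; apply: reduced_span_add; [apply: IH|apply: IH'].
- by rewrite -!scalerAl; apply: reduced_spanZ; apply: IH.
- by rewrite -!mulrA; apply: IH; apply: IH'.
Qed.

Variables (D1 : set A1) (D2 : set A2) (E1 : A1 -> A1) (E2 : A2 -> A2).
Hypotheses (ce1 : cond_exp D1 E1) (ce2 : cond_exp D2 E2).
Hypotheses (jD1 : forall b, D1 (j1 b)) (jD2 : forall b, D2 (j2 b)).
Hypothesis red1 : forall e s, reduced EC Etheta e s -> E1 (word j1 u1 e s) = 0.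
Hypothesis red2 : forall e s, reduced EC Etheta e s -> E2 (word j2 u2 e s) = 0.

Lemma hnn_graph_cond_exp x y : hnn_graph x y ->
  exists2 b, E1 x = j1 b & E2 y = j2 b.
Proof.
move/hnn_graph_reduced; elim=> {x y} [b|b e s b' h|x y x' y' _ [b h1 h2] _ [b' h1' h2']].
- by exists b; rewrite ?(cond_exp_id ce1) ?(cond_exp_id ce2).
- exists 0; rewrite raddf0.
    by rewrite (cond_exp_bimodule ce1) // red1 // mulr0 mul0r.
  by rewrite (cond_exp_bimodule ce2) // red2 // mulr0 mul0r.
- exists (b + b'); rewrite raddfD.
    by rewrite (ceD ce1) h1 h1'.
  by rewrite (ceD ce2) h2 h2'.
Qed.

End HNNGraph.

(** * Matrix units *)

Section StarHomConstruction.
Variables (R : realType) (A B : starAlgType R) (f : A -> B).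

Lemma starhom_exists : (forall x y, f (x - y) = f x - f y) ->
  f 1 = 1 -> (forall x y, f (x * y) = f x * f y) ->
  (forall (z : R[i]) x, f (z *: x) = z *: f x) -> (forall x, f (star x) = star (f x)) ->
  exists g : {starhom A -> B}, forall x, g x = f x.
Proof.
move=> fB f1 fM fZ fs.
pose m1 := GRing.isZmodMorphism.Build A B f fB.
pose m2 := GRing.isMonoidMorphism.Build A B f (conj f1 fM).
pose m3 := GRing.isScalable.Build R[i] A B *:%R f fZ.
pose m4 := isStarPreserving.Build R A B f fs.
pose g : {starhom A -> B} := HB.pack f m1 m2 m3 m4.
by exists g.
Qed.

End StarHomConstruction.

Section MatrixUnits.
Variables (R : realType) (A : cstarAlgType R) (e : 'I_2 -> 'I_2 -> A).
Hypothesis eM : forall i j k l, e i j * e k l = if j == k then e i l else 0.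
Hypothesis e1 : \sum_i e i i = 1.
Hypothesis e_star : forall i j, star (e i j) = e j i.

(* The [(i, j)] entry of [x], spread along the diagonal. *)
Definition entry i j (x : A) := \sum_k e k i * x * e j k.

Lemma cnorm_munit i j : cnorm (e i j) <= 1.
Proof.
have h0 := cnorm_ge0 (e j j); have h0' := cnorm_ge0 (e i j).
have := cnorm_star (e j j); rewrite e_star eM eqxx => h.
have := cnorm_star (e i j); rewrite e_star eM eqxx => h'.
have h1 : cnorm (e j j) <= 1 by rewrite leNgt; apply/negP => lt; nra.
by rewrite leNgt; apply/negP => lt; nra.
Qed.

Lemma entryD i j x y : entry i j (x + y) = entry i j x + entry i j y.
Proof. by rewrite /entry -big_split; apply: eq_bigr => k _; rewrite mulrDr mulrDl. Qed.

Lemma entryZ i j (z : R[i]) x : entry i j (z *: x) = z *: entry i j x.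
Proof.
by rewrite /entry scaler_sumr; apply: eq_bigr => k _; rewrite -scalerAr -scalerAl.
Qed.

Lemma entryB i j x y : entry i j (x - y) = entry i j x - entry i j y.
Proof. by rewrite -scaleN1r entryD entryZ scaleN1r. Qed.

Lemma entry_star i j x : entry i j (star x) = star (entry j i x).
Proof.
rewrite /entry (big_morph _ (@starD R A) (star0 A)); apply: eq_bigr => k _.
by rewrite !starM !e_star mulrA.
Qed.

Lemma entry_mul_diag i j k x y :
  entry i j x * entry j k y = entry i k (x * e j j * y).
Proof.
rewrite /entry big_distrl; apply: eq_bigr => l _ /=.
rewrite big_distrr (bigD1 l) //= big1 ?addr0.
  by rewrite -(mulrA _ (e j l)) !(mulrA (e j l)) eM eqxx !mulrA.
by move=> m ml; rewrite -(mulrA _ (e j l)) !(mulrA (e j l)) eM eq_sym (negPf ml) !mul0r mulr0.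
Qed.

Lemma entryM i j x y : entry i j (x * y) = \sum_k entry i k x * entry k j y.
Proof.
under eq_bigr => k _ do rewrite entry_mul_diag.
rewrite -[in LHS](mulr1 x) -e1 mulr_sumr mulr_suml /entry exchange_big /=.
by apply: eq_bigr => k _; rewrite mulr_sumr mulr_suml.
Qed.

Lemma entry_comm i j x k l : entry i j x * e k l = e k l * entry i j x.
Proof.
rewrite /entry mulr_suml mulr_sumr (bigD1 k) //= [RHS](bigD1 l) //=.
rewrite !big1 ?addr0.
- by rewrite -mulrA eM eqxx !mulrA eM eqxx.
- by move=> m ml; rewrite !mulrA eM eq_sym (negPf ml) !mul0r.
- by move=> m mk; rewrite -mulrA eM (negPf mk) mulr0.
Qed.

Lemma entry_decomp x : x = \sum_i \sum_j entry i j x * e i j.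
Proof.
rewrite -{1}(mul1r x) -{1}(mulr1 (1 * x)) -e1 mulr_suml mulr_suml.
apply: eq_bigr => i _; rewrite mulr_sumr; apply: eq_bigr => j _.
rewrite /entry mulr_suml (bigD1 i) //= big1 ?addr0.
  by rewrite -[RHS]mulrA eM eqxx.
by move=> k ki; rewrite -mulrA eM (negPf ki) mulr0.
Qed.

Lemma entry_munit x : (forall i j, x * e i j = e i j * x) -> forall i j k l,
  entry i j (x * e k l) = if (i == k) && (l == j) then x else 0.
Proof.
move=> cx i j k l; case: ifP => h.
  have /andP[/eqP<- /eqP->] := h.
  rewrite -[RHS]mulr1 -e1 mulr_sumr; apply: eq_bigr => m _.
  by rewrite mulrA -cx -!mulrA !(eqxx, eM).
rewrite /entry big1 // => m _; rewrite mulrA -cx -!mulrA eM.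
case: (l == j) h => [|_]; last by rewrite !mulr0.
by rewrite andbT eM => ->; rewrite mulr0.
Qed.

Lemma entry_center x i : (forall i j, x * e i j = e i j * x) -> entry i i x = x.
Proof.
move=> cx; rewrite /entry -[RHS]mulr1 -e1 mulr_sumr; apply: eq_bigr => k _.
by rewrite -cx -mulrA eM eqxx.
Qed.

Lemma entry_sum i j I (r : seq I) (F : I -> A) :
  entry i j (\sum_(a <- r) F a) = \sum_(a <- r) entry i j (F a).
Proof.
apply: (big_morph (entry i j) (entryD i j)).
by have := entryZ i j 0 0; rewrite !scale0r.
Qed.

Lemma entry_inj x y : (forall i j, entry i j x = entry i j y) -> x = y.
Proof.
move=> h; rewrite (entry_decomp x) (entry_decomp y).
by apply: eq_bigr => i _; apply: eq_bigr => j _; rewrite h.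
Qed.

(** The constant counts the two summands. It is crude, but only continuity of [entry] matters. *)
Lemma cnorm_entry i j x : cnorm (entry i j x) <= 2 * cnorm x.
Proof.
have h k : cnorm (e k i * x * e j k) <= cnorm x.
  apply: le_trans (cnormM _ _) _; rewrite -[leRHS]mulr1.
  apply: ler_pM; rewrite ?cnorm_ge0 ?cnorm_munit //.
  apply: le_trans (cnormM _ _) _; rewrite -[leRHS]mul1r.
  by apply: ler_pM; rewrite ?cnorm_ge0 ?cnorm_munit.
rewrite /entry !big_ord_recl big_ord0 addr0.
by apply: le_trans (cnormD _ _) _; have := h 0; have := h (lift 0 0); lra.
Qed.

End MatrixUnits.

Section MatrixAlgebra.
Variables (R : realType) (B C : cstarAlgType R).
Implicit Types m z : M2 B.

Definition munit (i j : 'I_2) : M2 B :=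
  \matrix_(k, l) (if (k == i) && (l == j) then 1 else 0).

Lemma mat2_eta m : m = mat2 (m 0 0) (m 0 1) (m 1 0) (m 1 1).
Proof.
apply/matrixP => i j; rewrite mxE.
by case: i => [[|[|//]] hi]; case: j => [[|[|//]] hj] /=; congr (m _ _); apply: val_inj.
Qed.

Lemma munitM i j k l : munit i j * munit k l = if j == k then munit i l else 0.
Proof.
apply/matrixP => a b; rewrite mxE (bigD1 j) //= big1 ?addr0 => [|c cj].
  rewrite !mxE eqxx andbT.
  by case: (j == k); rewrite !mxE /= ?mulr0 //; case: (a == i); rewrite ?mul0r ?mul1r.
by rewrite !mxE (negPf cj) andbF mul0r.
Qed.

Lemma munit1 : \sum_i munit i i = 1.
Proof.
apply/matrixP => a b; rewrite !mxE summxE (bigD1 a) //= big1 ?addr0 => [|c ca].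
  by rewrite mxE eqxx eq_sym /=; case: eqP.
by rewrite mxE eq_sym (negPf ca).
Qed.

Lemma munit_star i j : star (munit i j) = munit j i.
Proof.
by apply/matrixP => a b; rewrite !mxE andbC; case: ifP; rewrite ?star1 ?star0.
Qed.

Lemma munit_mat2 : [/\ munit 0 0 = mat2 1 0 0 0, munit 0 1 = mat2 0 1 0 0,
  munit 1 0 = mat2 0 0 1 0 & munit 1 1 = mat2 0 0 0 1].
Proof.
by split; apply/matrixP => a b; rewrite !mxE;
   case: a => [[|[|//]] ha]; case: b => [[|[|//]] hb].
Qed.

Lemma diag_munitC b i j : mat2 b 0 0 b * munit i j = munit i j * mat2 b 0 0 b.
Proof.
rewrite (mat2_eta (munit i j)) !mat2M !mulr0 !mul0r !addr0 !add0r !mxE.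
by congr mat2; case: ifP; rewrite ?mulr1 ?mul1r ?mulr0 ?mul0r.
Qed.

Lemma mat2_decomp m : m = \sum_i \sum_j mat2 (m i j) 0 0 (m i j) * munit i j.
Proof.
have [e00 e01 e10 e11] := munit_mat2.
rewrite !big_ord_recl !big_ord0 !addr0.
rewrite (_ : lift 0 0 = 1) ?e00 ?e01 ?e10 ?e11; last exact: val_inj.
by rewrite !mat2M !mul0r !mulr1 !mulr0 !addr0 !add0r !mat2D !addr0 !add0r -mat2_eta.
Qed.

(** The test vectors [mat2 x 0 0 0] and [mat2 0 0 x 0] bring each column [(a, b)] of [m] to the
    upper left entry, where [EC] sees [star x * (star a * a + star b * b) * x]. Positivity separates
    the two summands. *)
Lemma nondegenerate_E_diag (D : set B) (EC Etheta : B -> B) :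
  cond_exp D EC -> nondegenerate_ce EC -> nondegenerate_ce (E_diag EC Etheta).
Proof.
move=> ce nd m h.
have main (a b : B) : (forall x, EC (star x * (star a * a + star b * b) * x) = 0) ->
    a = 0 /\ b = 0.
  move=> hab.
  have key x : EC (star x * star a * a * x) = 0 /\ EC (star x * star b * b * x) = 0.
    have p c : pos (EC (star x * star c * c * x)).
      by apply: (ce_pos ce); rewrite -(mulrA (star x)); apply: pos_conj; apply: pos_star_mul.
    have := hab x; rewrite mulrDr mulrDl !mulrA (ceD ce) => /eqP.
    rewrite addr_eq0 => /eqP e; suff eb : EC (star x * star b * b * x) = 0.
      by rewrite e eb oppr0.
    by apply: pos_antisym; rewrite // -e.
  by split; apply: nd => x; have [] := key x.
have [m00 m10] : m 0 0 = 0 /\ m 1 0 = 0.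
  apply: main => x; have := congr1 (fun y : M2 B => y 0 0) (h (mat2 x 0 0 0)).
  rewrite [X in E_diag _ _ X](_ : _ = mat2 (star x *
    (star (m 0 0) * m 0 0 + star (m 1 0) * m 1 0) * x) 0 0 0).
    by rewrite /E_diag !mxE.
  rewrite {1 2}(mat2_eta m) !mat2_star !mat2M !star0 !mulr0 !mul0r !addr0 ?add0r.
  by rewrite !mulrDl !mulrDr !mulrDl !mulrA !mul0r !addr0.
have [m01 m11] : m 0 1 = 0 /\ m 1 1 = 0.
  apply: main => x; have := congr1 (fun y : M2 B => y 0 0) (h (mat2 0 0 x 0)).
  rewrite [X in E_diag _ _ X](_ : _ = mat2 (star x *
    (star (m 0 1) * m 0 1 + star (m 1 1) * m 1 1) * x) 0 0 0).
    by rewrite /E_diag !mxE.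
  rewrite {1 2}(mat2_eta m) !mat2_star !mat2M !star0 !mulr0 !mul0r !addr0 ?add0r.
  by rewrite !mulrDl !mulrDr !mulrDl !mulrA !mul0r !addr0 ?add0r.
by rewrite (mat2_eta m) m00 m01 m10 m11; apply/matrixP => i j; rewrite !mxE; case: ifP; case: ifP.
Qed.

End MatrixAlgebra.

(** * The free product *)

Lemma Forall_rcons T (P : T -> Prop) s x :
  List.Forall P s -> P x -> List.Forall P (rcons s x).
Proof. by elim: s => [|y s IH] /= h hx; inversion h; subst; constructor; auto. Qed.

Lemma E_diag_eq0 (R : realType) (B : starAlgType R) (f g : B -> B) (x : M2 B) :
  f (x 0 0) = 0 -> g (x 1 1) = 0 -> E_diag f g x = 0.
Proof.
move=> h h'; rewrite /E_diag h h'; apply/matrixP => i j; rewrite !mxE.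
by do 2 case: ifP.
Qed.

Section FreeProduct.
Variables (R : realType) (B C A : cstarAlgType R).
Variables (iC theta : {starhom C -> B}) (EC Etheta : B -> B).
Variables (lamtheta : {starhom M2 B -> A}) (lam1 : {starhom M2 C -> A}).
Variables (EE EEtheta : A -> A) (L : {starhom B -> A}).
Hypotheses (ceC : cond_exp (range iC) EC) (ndC : nondegenerate_ce EC).
Hypothesis ceT : cond_exp (range theta) Etheta.
Hypothesis fp : reduced_amalgamated_free_product
  (iota_diag iC theta) (iota_diag idfun idfun)
  (E_diag EC Etheta) (E_diag idfun idfun) lamtheta lam1 EE.
Hypothesis ceEt : cond_exp (range lamtheta) EEtheta.
Hypothesis EEEt : forall x, EE (EEtheta x) = EE x.
Hypothesis LE : forall b, L b = lamtheta (mat2 b 0 0 b).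

Let e i j := lamtheta (munit B i j).

Let eM i j k l : e i j * e k l = if j == k then e i l else 0.
Proof. by rewrite /e -rmorphM munitM; case: ifP; rewrite ?raddf0. Qed.

Let e1 : \sum_i e i i = 1.
Proof. by rewrite -(rmorph1 lamtheta) -munit1 raddf_sum. Qed.

Let e_star i j : star (e i j) = e j i.
Proof. by rewrite /e -star_morph munit_star. Qed.

Let eL b i j : L b * e i j = e i j * L b.
Proof. by rewrite LE /e -!rmorphM /= diag_munitC. Qed.

Let e00E : e 0 0 = lamtheta (mat2 1 0 0 0).
Proof. by have [h _ _ _] := munit_mat2 B; rewrite /e h. Qed.
Let e01E : e 0 1 = lamtheta (mat2 0 1 0 0).
Proof. by have [_ h _ _] := munit_mat2 B; rewrite /e h. Qed.
Let e10E : e 1 0 = lamtheta (mat2 0 0 1 0).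
Proof. by have [_ _ h _] := munit_mat2 B; rewrite /e h. Qed.

Lemma lamtheta_decomp m : lamtheta m = \sum_i \sum_j L (m i j) * e i j.
Proof.
rewrite {1}(mat2_decomp m) raddf_sum; apply: eq_bigr => i _.
by rewrite raddf_sum; apply: eq_bigr => j _; rewrite /= rmorphM /= LE.
Qed.

Lemma entry_lamtheta i j m : entry e i j (lamtheta m) = L (m i j).
Proof.
rewrite lamtheta_decomp entry_sum (bigD1 i) //= [X in _ + X]big1 ?addr0 => [|k ki].
  rewrite entry_sum (bigD1 j) //= [X in _ + X]big1 ?addr0 => [|l lj].
    by rewrite (entry_munit eM e1 (eL _)) !eqxx.
  by rewrite (entry_munit eM e1 (eL _)) (negPf lj) andbF.
rewrite entry_sum big1 // => l _.
by rewrite (entry_munit eM e1 (eL _)) eq_sym (negPf ki).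
Qed.

Let De i j : range lamtheta (e i j). Proof. by exists (munit B i j). Qed.

Lemma entry_EEtheta i j x : entry e i j (EEtheta x) = EEtheta (entry e i j x).
Proof.
rewrite /entry (ce_sum ceEt); apply: eq_bigr => k _.
by rewrite (cond_exp_bimodule ceEt).
Qed.

(** If [EEtheta x = lamtheta m], the choice [y = star z * star m] turns the hypothesis into
    [E_diag (star z * star m * m * z) = 0], by bimodularity and [EE] composed with [EEtheta].
    Vanishing of [EEtheta] thus becomes a question about [EE], to which freeness applies. *)
Lemma EEtheta_eq0 x :
  (forall y z, EE (lamtheta y * x * lamtheta z) = 0) -> EEtheta x = 0.
Proof.
move=> h; have [m _ em] := cond_exp_range ceEt x.
suff m0 : m = 0 by rewrite -em m0 raddf0.
apply: (nondegenerate_E_diag ceC ndC (Etheta := Etheta)) => z.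
apply: (rafp_inj1 fp); rewrite raddf0 -(rafp_E1 fp).
rewrite !(rmorphM lamtheta) /= em -(rmorphM lamtheta) /=.
by rewrite -(cond_exp_bimodule ceEt) ?EEEt.
Qed.

Lemma EEtheta_nondegenerate : nondegenerate_ce EEtheta.
Proof.
move=> b h; apply: (rafp_nondegenerate fp) => x.
by rewrite -EEEt h (ce0 (rafp_cond_exp fp)).
Qed.

(* [EEtheta] restricted to a set containing all entries is already
   non-degenerate: the null vectors form a right [M_2]-submodule. *)
Lemma EEtheta_nondegenerate_entry d :
  (forall i j x, EEtheta (star (entry e i j x) * star d * d * entry e i j x) = 0) ->
  d = 0.
Proof.
move=> h; apply: EEtheta_nondegenerate => x.
have -> : star x * star d * d * x = star (d * x) * (d * x).
  by rewrite starM !mulrA.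
rewrite {1 2}(entry_decomp eM e1 x) mulr_sumr; apply: (ce_null_sum ceEt) => i.
rewrite mulr_sumr; apply: (ce_null_sum ceEt) => j.
rewrite (mulrA d); apply: (ce_null_mulr ceEt) => //; first by rewrite e_star.
by rewrite starM !mulrA.
Qed.

Definition off_unit (ep : bool) : M2 C := if ep then mat2 0 1 0 0 else mat2 0 0 1 0.

(** An arbitrary coefficient is allowed so that diagonal remainders from neighbouring letters can be
    absorbed without losing centeredness. *)
Definition off_diag (ep : bool) (m : M2 C) := exists c : C,
  m = if ep then mat2 0 c 0 0 else mat2 0 0 c 0.

(* In the corner [e_11], the power [W^ep] is [left_unit * off_unit * right_unit]. *)
Definition left_unit (ep : bool) : M2 B := if ep then mat2 1 0 0 0 else mat2 0 1 0 0.
Definition right_unit (ep : bool) : M2 B := if ep then mat2 0 0 1 0 else mat2 1 0 0 0.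

(** Everything between two off-diagonal letters is merged into one letter of [M2 B], so the product
    alternates visibly. The first off-diagonal letter is left out because it may have to be
    modified. *)
Fixpoint corner_tail (ep : bool) (s : seq (B * bool)) : A :=
  if s is (b, ep') :: s' then
    lamtheta (right_unit ep * mat2 b 0 0 0 * left_unit ep') * lam1 (off_unit ep') *
    corner_tail ep' s'
  else lamtheta (right_unit ep).

Definition corner_word ep s := lamtheta (left_unit ep) * lam1 (off_unit ep) * corner_tail ep s.

Let diagE (c1 c2 : C) : lamtheta (mat2 (iC c1) 0 0 (theta c2)) = lam1 (mat2 c1 0 0 c2).
Proof. exact: (rafp_amalg fp (c1, c2)). Qed.

Local Notation m2s := (mulr0, mul0r, mulr1, mul1r, addr0, add0r).

Let v : A := lam1 (mat2 0 1 0 0).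

Let e00_1 : e 0 0 = lam1 (mat2 1 0 0 0).
Proof. by rewrite -diagE e00E rmorph1 raddf0. Qed.

Let e11_1 : lamtheta (mat2 0 0 0 1) = lam1 (mat2 0 0 0 1).
Proof. by rewrite -diagE rmorph1 raddf0. Qed.

Let e00_v : e 0 0 * v = v.
Proof. by rewrite e00_1 -rmorphM mat2M !m2s. Qed.

Let off_unitE ep : lam1 (off_unit ep) = upow v ep.
Proof.
by case: ep => //=; rewrite /v -star_morph mat2_star star0 star1.
Qed.

(** [v * e 1 0] is a unitary of the corner of [e 0 0]; spread along the diagonal it commutes with
    the matrix units and corresponds to [u] tensored with the identity matrix. *)
Definition hnn_unitary : A := entry e 0 0 (v * e 1 0).

Let W := hnn_unitary.

Lemma hnn_unitary_comm i j : W * e i j = e i j * W.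
Proof. exact: entry_comm. Qed.

Let W_pow ep : upow W ep =
  entry e 0 0 (lamtheta (left_unit ep) * lam1 (off_unit ep) * lamtheta (right_unit ep)).
Proof.
rewrite off_unitE; case: ep => /=; first by rewrite -e00E -e10E e00_v.
rewrite /W /hnn_unitary -(entry_star e_star) starM e_star -e01E -e00E.
by rewrite -{1}e00_v starM e_star mulrA.
Qed.

Lemma hnn_unitaryl : star W * W = 1.
Proof.
rewrite /W /hnn_unitary -(entry_star e_star) (entry_mul_diag eM) starM e_star.
rewrite -!mulrA (mulrA (e 0 0) v) e00_v (mulrA (star v) v).
have -> : star v * v * e 1 0 = e 1 0.
  rewrite /v -star_morph -rmorphM /= mat2_star mat2M !star0 star1.
  by rewrite !m2s -e11_1 e10E -rmorphM mat2M !m2s.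
rewrite eM eqxx; apply/esym; rewrite -[LHS](entry_center eM e1 (x := 1) 0) //.
  by rewrite /entry; apply: eq_bigr => k _; rewrite mulr1 -mulrA !(eqxx, eM).
by move=> i j; rewrite mulr1 mul1r.
Qed.

Let W_conj m : W * entry e 0 0 (lamtheta m) * star W =
  entry e 0 0 (v * lamtheta (mat2 0 0 0 (m 0 0)) * star v).
Proof.
have -> : lamtheta (mat2 0 0 0 (m 0 0)) =
    e 1 0 * e 0 0 * lamtheta m * e 0 0 * e 0 1.
  by rewrite e10E e00E e01E {2}(mat2_eta m) -!rmorphM /= !mat2M !m2s.
rewrite /W /hnn_unitary -(entry_star e_star) !(entry_mul_diag eM).
by rewrite starM e_star !mulrA.
Qed.

(** Amalgamation identifies [theta c] in the lower right corner of [M2 B] with [c] in that of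
    [M2 C]. Conjugation by [v] moves it to the upper left corner, where amalgamation reads it as
    [iC c]. *)
Lemma hnn_unitary_cov c : W * L (theta c) * star W = L (iC c).
Proof.
have -> : L (theta c) = entry e 0 0 (lamtheta (mat2 (theta c) 0 0 0)).
  by rewrite entry_lamtheta mxE.
have h1 : lamtheta (mat2 0 0 0 (theta c)) = lam1 (mat2 0 0 0 c).
  by rewrite -diagE raddf0.
have h2 : lam1 (mat2 c 0 0 0) = lamtheta (mat2 (iC c) 0 0 0).
  by rewrite -diagE raddf0.
rewrite W_conj mxE /= h1 /v -star_morph mat2_star !star0 star1.
by rewrite -!rmorphM /= !mat2M !m2s h2 entry_lamtheta mxE.
Qed.

Lemma word_corner ep s : word L W ep s = entry e 0 0 (corner_word ep s).
Proof.
rewrite /corner_word; elim: s ep => [|[b ep'] s IH] ep /=; first exact: W_pow.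
have -> : L b = entry e 0 0 (lamtheta (mat2 b 0 0 0)).
  by rewrite entry_lamtheta mxE.
rewrite W_pow IH !(entry_mul_diag eM); congr (entry e 0 0 _).
have -> : right_unit ep * mat2 b 0 0 0 * left_unit ep' =
    right_unit ep * mat2 1 0 0 0 * mat2 b 0 0 0 * mat2 1 0 0 0 * left_unit ep'.
  by case: (ep); case: (ep'); rewrite /= !mat2M !m2s.
by rewrite !rmorphM /= e00E !mulrA.
Qed.

Let letter := letter_val lamtheta lam1.
Let centered := letter_centered (E_diag EC Etheta) (E_diag (@idfun C) (@idfun C)).

Let rafp_path p : p <> [::] -> alternating p -> List.Forall centered p ->
  EE (\prod_(x <- p) letter x) = 0.
Proof. exact: (rafp_free fp). Qed.

Lemma alternating_rcons (P1 P2 : starAlgType R) (p : seq (P1 + P2)) x y :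
  alternating (rcons (rcons p x) y) =
  alternating (rcons p x) && (letter_side x != letter_side y).
Proof.
rewrite /alternating; case: p => [|z p] /=; first by rewrite andbT.
by rewrite rcons_path last_rcons.
Qed.

Let off_diag_centered ep m : off_diag ep m -> centered (inr m).
Proof.
by case=> c ->; apply: E_diag_eq0; rewrite /=; case: ep; rewrite !mxE.
Qed.

Let off_diag_mulr ep m (c1 c2 : C) : off_diag ep m -> off_diag ep (m * mat2 c1 0 0 c2).
Proof.
case=> c ->; case: ep; rewrite mat2M !m2s; [exists (c * c2)|exists (c * c1)] => //.
Qed.

Let off_diag_mull ep m (c1 c2 : C) : off_diag ep m -> off_diag ep (mat2 c1 0 0 c2 * m).
Proof.
case=> c ->; case: ep; rewrite mat2M !m2s; [exists (c1 * c)|exists (c2 * c)] => //.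
Qed.

(** The remainder lies in the amalgamated subalgebra, so it can be passed to an adjacent letter of
    [M2 C]. *)
Lemma E_diag_split (m : M2 B) : exists c1 c2 : C, exists2 m0 : M2 B,
  m = m0 + mat2 (iC c1) 0 0 (theta c2) & centered (inl m0).
Proof.
have [c1 _ h1] := cond_exp_range ceC (m 0 0).
have [c2 _ h2] := cond_exp_range ceT (m 1 1).
exists c1, c2, (m - mat2 (iC c1) 0 0 (theta c2)); first by rewrite subrK.
apply: E_diag_eq0; rewrite !mxE /= ?(ceB ceC) ?(ceB ceT).
  by rewrite h1 (cond_exp_id ceC (cond_exp_range ceC _)) subrr.
by rewrite h2 (cond_exp_id ceT (cond_exp_range ceT _)) subrr.
Qed.

Lemma EE_corner_tail_eq0 s ep p m z : reduced EC Etheta ep s -> off_diag ep m ->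
  alternating (rcons p (inr m)) -> List.Forall centered p ->
  EE (\prod_(x <- p) letter x * lam1 m * corner_tail ep s * lamtheta z) = 0.
Proof.
elim: s ep p m => [|[b ep'] s IH] ep p m /= red od alt cen; last first.
  case: red => hT hC red.
  (* Equal exponents put [b] off the diagonal. The change from 1 to -1 puts it in the lower right
     entry, seen by [Etheta], and the change from -1 to 1 in the upper left one, seen by [EC]:
     exactly the cases where reducedness centers [b]. *)
  set mid := right_unit ep * mat2 b 0 0 0 * left_unit ep'.
  have cmid : centered (inl mid).
    by apply: E_diag_eq0; rewrite /mid; move: hT hC; case: (ep); case: (ep') => /= hT hC;
      rewrite !mat2M !m2s !mxE /= ?hT ?hC ?(ce0 ceC) ?(ce0 ceT).
  have := IH ep' (rcons (rcons p (inr m)) (inl mid)) (off_unit ep') red.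
  rewrite !big_rcons /= !mulrA; apply.
  - by exists 1; case: (ep').
  - by rewrite !alternating_rcons alt.
  - by apply: Forall_rcons => //; apply: Forall_rcons => //; apply: off_diag_centered od.
(* The last letter is arbitrary. Its centered part prolongs the alternating word, and its diagonal
   part is absorbed into [m], which stays off-diagonal. *)
rewrite -mulrA -rmorphM /=; set z' := right_unit ep * z.
have [c1 [c2 [m0 -> cm0]]] := E_diag_split z'.
rewrite raddfD /= mulrDr (ceD (rafp_cond_exp fp)) diagE.
have := @rafp_path (rcons (rcons p (inr m)) (inl m0)).
rewrite !big_rcons /= => ->; rewrite ?add0r.
- rewrite -mulrA -rmorphM /=.
  have od' := off_diag_mulr c1 c2 od.
  have := @rafp_path (rcons p (inr (m * mat2 c1 0 0 c2))).
  rewrite !big_rcons /=; apply; first by case: (p).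
    by move: alt; case/lastP: (p) => // q x; rewrite !alternating_rcons.
  by apply: Forall_rcons => //; apply: off_diag_centered od'.
- by case: (p).
- by rewrite alternating_rcons alt.
- by apply: Forall_rcons => //; apply: Forall_rcons => //; apply: off_diag_centered od.
Qed.

(** The left end is treated like the right one: its centered part starts the prefix, its diagonal
    part changes the coefficient of the first off-diagonal letter. *)
Lemma EE_corner_word_eq0 ep s y z : reduced EC Etheta ep s ->
  EE (lamtheta y * corner_word ep s * lamtheta z) = 0.
Proof.
move=> red; rewrite /corner_word !mulrA -rmorphM /=.
have [c1 [c2 [m0 -> cm0]]] := E_diag_split (y * left_unit ep).
rewrite raddfD /= !mulrDl (ceD (rafp_cond_exp fp)) diagE.
have od : off_diag ep (off_unit ep) by exists 1; case: (ep).
have := @EE_corner_tail_eq0 s ep [:: inl m0] (off_unit ep) z red od.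
rewrite big_seq1 /= => ->; rewrite ?add0r //; last by constructor.
rewrite -rmorphM /=.
have := @EE_corner_tail_eq0 s ep [::] _ z red (off_diag_mull c1 c2 od).
by rewrite big_nil mul1r; apply.
Qed.

Lemma EEtheta_word_eq0 ep s : reduced EC Etheta ep s -> EEtheta (word L W ep s) = 0.
Proof.
move=> red; rewrite word_corner -entry_EEtheta EEtheta_eq0.
  by have := entryZ e 0 0 0 0; rewrite !scale0r.
by move=> y z; apply: EE_corner_word_eq0.
Qed.

Let vE : v = W * e 0 1.
Proof.
rewrite /W /hnn_unitary /entry mulr_suml (bigD1 0) //= big1 ?addr0.
  rewrite -mulrA eM eqxx (mulrA (e 0 0)) e00_v -mulrA e10E e01E -rmorphM /=.
  by rewrite mat2M !m2s e11_1 /v -rmorphM mat2M !m2s.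
by move=> k k0; rewrite -mulrA eM (negPf k0) mulr0.
Qed.

Let v_e10E : v * e 1 0 = W * e 0 0.
Proof. by rewrite vE -mulrA eM eqxx. Qed.

(** * Comparison with the reduced HNN extension *)

Variables (H : cstarAlgType R) (jB : {starhom B -> H}) (EB : H -> H) (u : H).
Hypothesis hnn : reduced_HNN iC theta EC Etheta jB EB u.

Let G := hnn_graph jB L u W.

Let aG : graph_algebra G.
Proof. exact: hnn_graph_algebra. Qed.

Let L_inj : injective L.
Proof.
move=> b b'; rewrite !LE => /(rafp_inj1 fp) /(congr1 (fun m : M2 B => m 0 0)).
by rewrite !mxE.
Qed.

Let LD b : range lamtheta (L b).
Proof. by rewrite LE; eexists. Qed.

Let GE x y : G x y -> exists2 b, EB x = jB b & EEtheta y = L b.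
Proof.
apply: (hnn_graph_cond_exp ceC ceT (HNN_unitaryl hnn) hnn_unitaryl
  (HNN_covariant hnn) hnn_unitary_cov (HNN_cond_exp hnn) ceEt) => //.
- exact: (HNN_reduced hnn).
- exact: EEtheta_word_eq0.
Qed.

Let sS := star_subalgebra_graph_range aG.

Let S_L b : graph_range G (L b).
Proof. by apply: graph_rangeI; apply: hnn_graph_base. Qed.

Let S_W : graph_range G W.
Proof. exact: graph_rangeI (hnn_graph_upow jB L u W true). Qed.

Let S_0 : graph_range G 0.
Proof. by rewrite -(raddf0 L); apply: S_L. Qed.

(** The elements all of whose entries lie in [graph_range G] form a closed star-subalgebra. It
    contains [lamtheta] and [v = W * e 0 1], and [M2 C] is generated by [v] and its diagonal, which
    is amalgamated into [M2 B]. *)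
Lemma entry_graph_range i j x : graph_range G (entry e i j x).
Proof.
pose T : set A := [set x | forall i j, graph_range G (entry e i j x)].
suff TT : T = setT by move: (I : setT x); rewrite -TT; apply.
have sT : star_subalgebra T.
  split=> [y z hy hz|t y hy|y z hy hz|y hy] k l.
  - by rewrite entryD; apply: (star_subalgebraD sS).
  - by rewrite entryZ; apply: (star_subalgebraZ sS).
  - rewrite (entryM eM e1) !big_ord_recl big_ord0 addr0.
    by apply: (star_subalgebraD sS); apply: (star_subalgebraM sS).
  - by rewrite (entry_star e_star); apply: (star_subalgebra_star sS).
have T_lam m : T (lamtheta m) by move=> k l; rewrite entry_lamtheta.
have T_v : T v.
  move=> k l; rewrite vE (entry_munit eM e1 hnn_unitary_comm).
  by case: ifP.
apply: (rafp_generated fp) => // [y hy k l|_ [[m _ <-]|[m _ <-]]] //.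
  apply: norm_closed_graph_range => r r0; have [|z Tz yz] := hy (r / 2).
    by rewrite divr_gt0.
  exists (entry e k l z) => //; rewrite -entryB.
  by have := cnorm_entry eM e_star k l (y - z); lra.
rewrite (_ : lam1 m = lam1 (mat2 (m 0 0) 0 0 (m 1 1)) +
    (lam1 (mat2 (m 0 1) 0 0 0) * v + star v * lam1 (mat2 (m 1 0) 0 0 0))).
  rewrite -(diagE (m 0 0)); apply: (star_subalgebraD sT) => //.
  have d0 c : lam1 (mat2 c 0 0 0) = lamtheta (mat2 (iC c) 0 0 0).
    by rewrite -diagE raddf0.
  rewrite !d0; apply: (star_subalgebraD sT); apply: (star_subalgebraM sT) => //.
  exact: (star_subalgebra_star sT).
rewrite {1}(mat2_eta m) /v -star_morph mat2_star star1 !star0 -!rmorphM -!rmorphD /=.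
by rewrite !mat2M !m2s !mat2D !m2s.
Qed.

Let aG' : graph_algebra (fun y x => G x y).
Proof.
split; [exact: (graph1 aG)| | | |] => *.
- exact: (graphD aG).
- exact: (graphZ aG).
- exact: (graphM aG).
- exact: (graph_star aG).
Qed.

Let full x : graph_range (fun y x => G x y) x.
Proof.
suff -> : graph_range (fun y x => G x y) = setT by [].
apply: (HNN_generated hnn); first exact: norm_closed_graph_range.
  exact: star_subalgebra_graph_range.
move=> _ [[b _ <-]|->].
  exact: (@graph_rangeI _ _ _ _ (L b)) (hnn_graph_base jB L u W b).
exact: (@graph_rangeI _ _ _ _ W) (hnn_graph_upow jB L u W true).
Qed.

(** The transfer is applied in both directions. Enough test vectors are available in [H] by [full],
    and in the free product because entries suffice and lie in [graph_range G]. *)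
Let isoG x y : G x y -> cnorm x = cnorm y.
Proof.
move=> g; apply/eqP; rewrite eq_le; apply/andP; split.
  have GE' y' x' : G x' y' -> exists2 b, EEtheta y' = L b & EB x' = jB b.
    by case/GE => b; exists b.
  apply: (transfer_cnorm_le L_inj ceEt (HNN_cond_exp hnn) aG' GE' _ g).
  by move=> d _ h; apply: (HNN_nondegenerate hnn) => z; apply: h.
apply: (transfer_cnorm_le (HNN_inj hnn) (HNN_cond_exp hnn) ceEt aG GE _ g).
move=> d _ h; apply: EEtheta_nondegenerate_entry => i j z; apply: h.
exact: entry_graph_range.
Qed.

Let Gb := graph_closure G.

Let aGb : graph_algebra Gb := graph_algebra_closure aG.

Let Gb_comm x y i j : Gb x y -> y * e i j = e i j * y.
Proof.
move=> g; apply: (@norm_closed_comm _ _ (e i j)) => r /g [x' [y' [g' _ h]]].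
exists y' => //=; elim: g' i j {h} => {x' y' r g}
  [b|ep|x1 y1 x2 y2 _ IH _ IH'|z x1 y1 _ IH|x1 y1 x2 y2 _ IH _ IH'] i j.
- exact: eL.
- case: ep => /=; first exact: hnn_unitary_comm.
  by apply: (can_inj (@starK R A)); rewrite !starM starK e_star -hnn_unitary_comm.
- by rewrite mulrDl mulrDr IH IH'.
- by rewrite -scalerAl -scalerAr IH.
- by rewrite -mulrA IH' mulrA IH mulrA.
Qed.

Let Gb_cond_exp x y : Gb x y -> Gb (EB x) (EEtheta y).
Proof.
move=> g r /g [x' [y' [g' h1 h2]]]; exists (EB x'), (EEtheta y'); split.
- by have [b -> ->] := GE g'; apply: hnn_graph_base.
- rewrite -(ceB (HNN_cond_exp hnn)); apply: le_lt_trans h1.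
  exact: (cond_exp_contractive (HNN_cond_exp hnn)).
- rewrite -(ceB ceEt); apply: le_lt_trans h2.
  exact: (cond_exp_contractive ceEt).
Qed.

(** The graph of the isomorphism to be built. Limits are taken entry by entry, in [H] and in [A], so
    no norm on [M2 H] enters. *)
Let rel (x : A) (m : M2 H) := forall i j, Gb (m i j) (entry e i j x).

Let rel_lamtheta m : rel (lamtheta m) (M2map jB m).
Proof.
move=> i j; rewrite entry_lamtheta mxE.
by apply: graph_closure_sub; apply: hnn_graph_base.
Qed.

Let relB x m x' m' : rel x m -> rel x' m' -> rel (x - x') (m - m').
Proof. by move=> h h' i j; rewrite entryB !mxE; apply: (graphB aGb). Qed.

Let relZ (z : R[i]) x m : rel x m -> rel (z *: x) (z *: m).
Proof. by move=> h i j; rewrite entryZ mxE; apply: (graphZ aGb). Qed.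

Let relM x m x' m' : rel x m -> rel x' m' -> rel (x * x') (m * m').
Proof.
move=> h h' i j; rewrite (entryM eM e1) mxE !big_ord_recl !big_ord0 !addr0.
by apply: (graphD aGb); apply: (graphM aGb).
Qed.

Let rel_star x m : rel x m -> rel (star x) (star m).
Proof. by move=> h i j; rewrite (entry_star e_star) mxE; apply: (graph_star aGb). Qed.

Let rel1 : rel 1 1.
Proof.
have := rel_lamtheta 1; rewrite rmorph1 (_ : M2map jB 1 = 1) //.
by apply/matrixP => i j; rewrite !mxE; case: (i == j); rewrite ?rmorph1 ?raddf0.
Qed.

Let rel_W i j : rel (W * e i j) (\matrix_(k, l) if (k == i) && (j == l) then u else 0).
Proof.
move=> k l; rewrite (entry_munit eM e1 hnn_unitary_comm) mxE.
case: ifP => _; apply: graph_closure_sub; first exact: (hnn_graph_upow jB L u W true).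
by have := hnn_graph_base jB L u W 0; rewrite !raddf0.
Qed.

Let rel_injl x x' m : rel x m -> rel x' m -> x = x'.
Proof.
move=> h h'; apply: (entry_inj eM e1) => i j.
exact: (graph_closure_injr aG isoG (h i j) (h' i j)).
Qed.

Let rel_injr x m m' : rel x m -> rel x m' -> m = m'.
Proof.
move=> h h'; apply/matrixP => i j.
exact: (graph_closure_injl aG isoG (h i j) (h' i j)).
Qed.

Let rel_totall x : exists m, rel x m.
Proof.
have /choice[f hf] (p : 'I_2 * 'I_2) : exists h : H, Gb h (entry e p.1 p.2 x).
  have isoG' y z : G z y -> cnorm y = cnorm z by move/isoG.
  have [h hh] := graph_closure_total aG' isoG' (entry_graph_range p.1 p.2 x).
  by exists h; apply: graph_closure_flip.
by exists (\matrix_(i, j) f (i, j)) => i j; rewrite mxE; apply: hf.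
Qed.

Let rel_totalr m : exists x, rel x m.
Proof.
have /choice[f hf] (p : 'I_2 * 'I_2) : exists y : A, Gb (m p.1 p.2) y.
  by have [y hy] := graph_closure_total aG isoG (full (m p.1 p.2)); exists y.
(* Partners commute with the matrix units, so the sum of the [f (i, j) * e i j] has exactly the
   prescribed entries. *)
have cf p i j : f p * e i j = e i j * f p by apply: Gb_comm (hf p).
exists (\sum_i \sum_j f (i, j) * e i j) => i j; rewrite entry_sum.
rewrite (bigD1 i) //= [X in _ + X]big1 ?addr0 => [|k ki]; last first.
  rewrite entry_sum big1 // => l _.
  by rewrite (entry_munit eM e1 (cf _)) eq_sym (negPf ki).
rewrite entry_sum (bigD1 j) //= [X in _ + X]big1 ?addr0 => [|l lj]; last first.
  by rewrite (entry_munit eM e1 (cf _)) (negPf lj) andbF.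
by rewrite (entry_munit eM e1 (cf _)) !eqxx; apply: (hf (i, j)).
Qed.

Lemma hnn_free_product_iso : exists Phi : {starhom A -> M2 H},
  [/\ bijective Phi, Phi @` range lamtheta = range (M2map jB),
      forall x, Phi (EEtheta x) = M2map EB (Phi x)
    & [/\ Phi (v * e 1 0) = mat2 u 0 0 0,
          forall b, Phi (lamtheta (mat2 b 0 0 0)) = mat2 (jB b) 0 0 0
        & Phi (e 0 1) = mat2 0 1 0 0]].
Proof.
have /choice[f hf] := rel_totall; have /choice[g hg] := rel_totalr.
(* [f] is a mere choice of partners; by uniqueness each law for [f] reduces to the stability of
   [rel] under the operation concerned. *)
have fE x m : rel x m -> f x = m by apply: rel_injr.
have [||||| Phi PhiE] := @starhom_exists R A (M2 H) f.
- by move=> x y; apply: fE; apply: relB.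
- exact: fE.
- by move=> x y; apply: fE; apply: relM.
- by move=> z x; apply: fE; apply: relZ.
- by move=> x; apply: fE; apply: rel_star.
have Phi_lam m : Phi (lamtheta m) = M2map jB m by rewrite PhiE; apply: fE.
exists Phi; split.
- exists g => [x|m]; rewrite ?PhiE.
    by apply: rel_injl (hg _) _; apply: hf.
  by apply: fE; apply: hg.
- apply/seteqP; split=> [_ [_ [m _ <-] <-]|_ [m _ <-]].
    by exists m => //; rewrite Phi_lam.
  by exists (lamtheta m); [exists m|rewrite Phi_lam].
- move=> x; rewrite !PhiE; apply: fE => i j.
  by rewrite entry_EEtheta mxE; apply: Gb_cond_exp; apply: hf.
split.
- rewrite v_e10E PhiE; apply: fE; have := rel_W 0 0; congr (rel _ _).
  by apply/matrixP => k l; rewrite !mxE (eq_sym 0); case: (k == 0); case: (l == 0).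
- move=> b; rewrite Phi_lam; apply/matrixP => i j; rewrite !mxE.
  by do 2 case: ifP => _; rewrite ?raddf0.
- rewrite e01E Phi_lam; apply/matrixP => i j; rewrite !mxE.
  by do 2 case: ifP => _; rewrite ?raddf0 ?rmorph1.
Qed.

End FreeProduct.

Theorem proposition2p2 (R : realType) (B C A AA : cstarAlgType R)
    (iC theta : {starhom C -> B}) (EC Etheta : B -> B)
    (jB : {starhom B -> A}) (EB : A -> A) (u : A)
    (lamtheta : {starhom M2 B -> AA}) (lam1 : {starhom M2 C -> AA})
    (EE EEtheta : AA -> AA) :
  injective iC -> injective theta ->
  cond_exp (range iC) EC -> nondegenerate_ce EC ->
  cond_exp (range theta) Etheta -> nondegenerate_ce Etheta ->
  reduced_HNN iC theta EC Etheta jB EB u ->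
  reduced_amalgamated_free_product
    (iota_diag iC theta) (iota_diag idfun idfun)
    (E_diag EC Etheta) (E_diag idfun idfun) lamtheta lam1 EE ->
  cond_exp (range lamtheta) EEtheta ->
  (forall x, EE (EEtheta x) = EE x) ->
  exists Phi : {starhom AA -> M2 A},
    [/\ bijective Phi,
        Phi @` range lamtheta = range (M2map jB),
        forall x, Phi (EEtheta x) = M2map EB (Phi x)
      & [/\ Phi (lam1 (mat2 0 1 0 0) * lamtheta (mat2 0 0 1 0))
              = mat2 u 0 0 0,
            forall b, Phi (lamtheta (mat2 b 0 0 0)) = mat2 (jB b) 0 0 0
          & Phi (lamtheta (mat2 0 1 0 0)) = mat2 0 1 0 0]].
Proof.
move=> _ _ ceC ndC ceT _ hnn fp ceEt EEEt.
(* [L] is the diagonal copy of [B], which commutes with the matrix units and so lies in [D] beside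
   [W]. *)
have [|||||L LE] := @starhom_exists R B AA (fun b => lamtheta (mat2 b 0 0 b)).
- by move=> x y; rewrite -raddfB mat2B subr0.
- by rewrite -mat2_1 rmorph1.
- by move=> x y; rewrite -rmorphM mat2M !(mulr0, mul0r, addr0, add0r).
- by move=> z x; rewrite -linearZ mat2Z scaler0.
- by move=> x; rewrite -star_morph mat2_star star0.
have := hnn_free_product_iso ceC ndC ceT fp ceEt EEEt LE hnn.
by have [_ -> -> _] := munit_mat2 B.
Qed.
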